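(* Let $R_n:=T(\eta_n,\mathbb{P}_n)-T(\eta_0,P_0)-(\mathbb{P}_n-P_0)\phi_n$ and $R_n^*:=T(\eta_n^*,\mathbb{P}_n^* )-T(\eta_n,\hat{P}_n)-(\mathbb{P}_n^*-\hat{P}_n)\phi_n^*$. Suppose that: (A1) there exists a class $\mathcal{F}$ of measurable functions from $(\mathcal{X},\mathcal{B})$ to $\mathbb{R}$ such that $\phi_0\in\mathcal{F}$, $P_0^*(\phi_n\in\mathcal{F})\to1$, and $\mathbb{G}_n$ converges weakly to the $P_0$-Brownian bridge $\mathbb{G}_0$ in $\ell^\infty(\mathcal{F})$; (A2) $\|\phi_n-\phi_0\|_{L_2(P_0)}=o_{P_0^*}(1)$; (A3) $R_n=o_{P_0^*}(n^{-1/2})$; (B1) there exists a class $\mathcal{F}$ of measurable functions from $(\mathcal{X},\mathcal{B})$ to $\mathbb{R}$ such that $\phi_0\in\mathcal{F}$, $P_W^*(\phi_n^*\in\mathcal{F})\to1$ in $P_0^*$-outer probability, and $\mathbb{G}_n^*$ converges weakly to the $P_0$-Brownian bridge $\mathbb{G}_0$ in $\ell^\infty(\mathcal{F})$ conditionally on the data in outer probability; (B2) $\|\phi_n^*-\phi_0\|_{L_2(P_0)}=o_{P_W^*}(1)$; (B3) $R_n^*=o_{P_W^*}(n^{-1/2})$; and that $T(\eta_n,\hat{P}_n)-T(\eta_n,\mathbb{P}_n)=o_{P_0^*}(n^{-1/2})$. Then Efron's percentile confidence interval $[\zeta_{n,\beta}^*,\zeta_{n,1-\alpha}^*]$ has asymptotic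 confidence level $1-\alpha-\beta$.
   Context: Data and estimator. $X_1,\dots,X_n \in \mathcal{X}\subseteq\mathbb{R}^d$ are IID from a probability measure $P_0$ on $(\mathcal{X},\mathcal{B})$ lying in a statistical model $\mathcal{M}$; $\mathbb{P}_n$ is the empirical distribution; $Pf := \int f\,dP$; $\mathbb{G}_n:=n^{1/2}(\mathbb{P}_n-P_0)$. $\psi:\mathcal{M}\to\mathbb{R}$ is the target parameter, $\psi_0=\psi(P_0)$, and $\phi_0:\mathcal{X}\to\mathbb{R}$ is an influence function, with $P_0\phi_0=0$ and $P_0\phi_0^2<\infty$. $\eta:\mathcal{M}\to\mathcal{H}$ is a nuisance parameter, $\eta_0=\eta(P_0)$, and $\eta_n\in\mathcal{H}$ is an estimator of $\eta_0$ based on the data. $T:\mathcal{H}\times\mathcal{M}^+\to\mathbb{R}$, where $\mathcal{M}^+$ is the union of $\mathcal{M}$ and the finite discrete probability measures, is such that $\psi_0=T(\eta_0,P_0)$, and the estimator is $\psi_n=T(\eta_n,\mathbb{P}_n)$. $\phi_n:\mathcal{X}\to\mathbb{R}$ is an estimator of $\phi_0$ based on the data. Bootstrap. $W_{n1},\dots,W_{nn}$ are IID with law $Q_n$ on $(\mathcal{W}_n,\mathcal{C}_n)$, independent of the data, and $X_i^*=\gamma_n(X_1,\dots,X_n,W_{ni})$ for a fixed measurable $\gamma_n$. $\hat{P}_n$ is the conditional law of $X_i^*$ given the data, so $X_1^*,\dots,X_n^*$ are conditionally IID from $\hat{P}_n$. $\mathbb{P}_n^*$ is the empirical distribution of $X_1^*,\dots,X_n^*$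 and $\mathbb{G}_n^* := n^{1/2}(\mathbb{P}_n^*-\hat{P}_n)$. $\eta_n^*\in\mathcal{H}$ is any nuisance estimator based on bootstrap and original data; $T(\eta_n,\hat P_n)$ is assumed well-defined; $\phi_n^*:\mathcal{X}\to\mathbb{R}$ is an estimator of $\phi_0$ that may depend on bootstrap and original data. Interval. $\alpha,\beta\in(0,1)$, $\alpha+\beta<1$. $\zeta_{n,p}^*:=\inf\{\zeta\in\mathbb{R}:P_W^*(T(\eta_n^*,\mathbb{P}_n^* )\le\zeta)\ge p\}$. An interval has asymptotic confidence level $1-\alpha-\beta$ if the $P_0^*$-probability that it contains $\psi_0$ converges to $1-\alpha-\beta$. Modes of convergence. $P_0^*$ is outer probability; $Y_n=o_{P_0^*}(r_n)$ means $Y_n/r_n\to0$ in $P_0^*$-outer probability. The conditional outer expectation $E_W^*h$ of a map $h$ of $(X_1,\dots,X_n,W_{n1},\dots,W_{nn})$ is the infimum of $\int U(X_1,\dots,X_n,w)\,dQ_n^n(w)$ over $U\ge h$ measurable in $w$ with existing integral; $P_W^*(A)=E_W^*1_A$. $Y_n=o_{P_W^*}(r_n)$ means that for every $\varepsilon>0$, $P_W^*(|Y_n|/r_n\ge\varepsilon)\to0$ in $P_0^*$-outer probability. $BL_1(\mathbb{D})$ is the set of 1-Lipschitz $h:\mathbb{D}\to[-1,1]$; $G_n$ converges weakly to a tight Borel measurable $G$ in $\mathbb{D}$ conditionally on the data in outer probability if $\sup_{h\in BL_1(\mathbb{D})}|E_W^*h(G_n)-E_0h(G)|\to0$ in $P_0^*$-outer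 probability. Unconditional weak convergence is in the Hoffmann–Jørgensen (outer expectation) sense. $\ell^\infty(\mathcal{F})$ is the space of bounded real functions on $\mathcal{F}$ with the supremum norm. The $P_0$-Brownian bridge $\mathbb{G}_0$ is the tight mean-zero Gaussian process with covariance $P_0(fg)-P_0f\,P_0g$.
   Formalization: The formal theorem adds P_0 φ_0² > 0 (if it is 0 the claim can fail), and reads P_0^*(φ_n∈F)→1 and P_W^*(φ_n^*∈F)→1 as: the outer probability of the complement tends to 0. These agree for measurable events; the literal reading fails for some nonmeasurable ones. *)

(* Defs.v *)
From HB Require Import structures.
From mathcomp Require Import all_boot all_order all_algebra.
From mathcomp Require Import all_classical all_reals all_analysis.
From mathcomp Require Import measurable_realfun.

Set Implicit Arguments.
Unset Strict Implicit.
Unset Printing Implicit Defensive.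

Import Order.TTheory GRing.Theory Num.Theory.
Import numFieldNormedType.Exports.

Local Open Scope classical_set_scope.
Local Open Scope ring_scope.

Section tuple_cons.
Context {d : measure_display} {S : measurableType d} (n : nat).

Definition tuple_cons (p : S * n.-tuple S) : n.+1.-tuple S :=
  [the n.+1.-tuple S of p.1 :: p.2].

Lemma measurable_tuple_cons : measurable_fun [set: S * n.-tuple S] tuple_cons.
Proof. by apply: measurable_cons; [exact: measurable_fst|exact: measurable_snd]. Qed.

HB.instance Definition _ :=
  isMeasurableFun.Build _ _ _ _ tuple_cons measurable_tuple_cons.
End tuple_cons.

(* The law of n IID draws from P, i.e. the n-fold product measure P^n. *)
Fixpoint iid_law (R : realType) (d : measure_display) (S : measurableType d)
    (P : probability S R) (n : nat) : probability (n.-tuple S) R :=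
  match n with
  | 0%N => (\d_([tuple] : 0.-tuple S) : probability (0.-tuple S) R)
  | m.+1 =>
      (distribution (P \x iid_law P m)%E
         (tuple_cons (S := S) (n := m)) : probability (m.+1.-tuple S) R)
  end.

(* For n = 0 this is the zero measure. *)
Definition empirical (R : realType) (d : measure_display) (S : measurableType d)
    (n : nat) (x : n.-tuple S) : {measure set S -> \bar R} :=
  mscale ((n%:R : R)^-1)%:nng
    (msum (fun i => \d_(nth point x i) : {measure set S -> \bar R}) n).

Definition scaled_diff (R : realType) (d : measure_display)
    (S : measurableType d) (n : nat) (m m0 : {measure set S -> \bar R})
    (f : S -> R) : R :=
  Num.sqrt n%:R * (\int[m]_y f y - \int[m0]_y f y).

Definition linear_remainder (R : realType) (d : measure_display)
    (S : measurableType d) (H : Type) (T : H -> {measure set S -> \bar R} -> R)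
    (h : H) (m : {measure set S -> \bar R})
    (h0 : H) (m0 : {measure set S -> \bar R}) (phi : S -> R) : R :=
  T h m - T h0 m0 - (\int[m]_y phi y - \int[m0]_y phi y).

Section bootstrap_sample.
Context (R : realType) {dS dW : measure_display} {S : measurableType dS}
  {W : measurableType dW} (n : nat).
Variable g : {mfun (n.-tuple S * W)%type >-> S}.

Definition resample (x : n.-tuple S) (w : W) : S := g (x, w).

Lemma measurable_resample x : measurable_fun [set: W] (resample x).
Proof. by apply: measurableT_comp => //; exact: pair1_measurable. Qed.

HB.instance Definition _ x :=
  isMeasurableFun.Build _ _ _ _ (resample x) (measurable_resample x).

(* The conditional law \hat P_n of X_i^* given the data x. *)
Definition resample_law (Q : probability W R) (x : n.-tuple S) :
  probability S R := distribution Q (resample x).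

Definition bootstrap_sample (x : n.-tuple S) (w : n.-tuple W) : n.-tuple S :=
  [tuple of map (resample x) w].

End bootstrap_sample.

Section outer.
Local Open Scope ereal_scope.
Context (R : realType) {d : measure_display} {S : measurableType d}.
Variable mu : {measure set S -> \bar R}.

Definition outer_expectation (h : S -> \bar R) : \bar R :=
  ereal_inf [set \int[mu]_w U w | U in [set U : S -> \bar R |
    [/\ measurable_fun [set: S] U,
        \int[mu]_w U^\+ w < +oo \/ \int[mu]_w U^\- w < +oo
      & forall w, h w <= U w]]].

Definition outer_prob (A : set S) : \bar R :=
  outer_expectation (fun w => (\1_A w)%:E).

End outer.

(* The bounded functions I -> R with the supremum distance; when I is empty
   the distance is sup set0 = 0. *)
Record linf (R : realType) (I : Type) := Linf {
  linf_fun :> I -> R ;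
  linf_bounded : has_ubound (range (fun i => `|linf_fun i|)) }.

Section linf_metric.
Context {R : realType} {I : Type}.
Implicit Types x y z : linf R I.

HB.instance Definition _ := gen_eqMixin (linf R I).
HB.instance Definition _ := gen_choiceMixin (linf R I).

Definition linf_dist x y : R := sup (range (fun i => `|x i - y i|)).

Let has_ubound_dist x y : has_ubound (range (fun i => `|x i - y i|)).
Proof.
have [a xa] := linf_bounded x; have [b yb] := linf_bounded y.
exists (a + b) => _ [i _ <-]; apply: (le_trans (ler_normB _ _)).
by apply: lerD; [apply: xa|apply: yb]; exists i.
Qed.

Let le_dist x y i : `|x i - y i| <= linf_dist x y.
Proof. by apply: ub_le_sup => //; exists i. Qed.

Let dist0 x y : (I -> False) -> linf_dist x y = 0.
Proof.
move=> nI; rewrite /linf_dist [X in sup X](_ : _ = set0) ?sup0//.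
by rewrite -subset0 => r [i _ _]; case: (nI i).
Qed.

Let dist_le x y (c : R) : 0 <= c -> (forall i, `|x i - y i| <= c) ->
  linf_dist x y <= c.
Proof.
move=> c0 xyc; have [[i]|nI] := pselect (inhabited I); last first.
  by rewrite dist0// => i; apply: nI.
apply: ge_sup; [by exists `|x i - y i|; exists i|move=> _ [j _ <-]; exact: xyc].
Qed.

Let dist_ge0 x y : 0 <= linf_dist x y.
Proof.
have [[i]|nI] := pselect (inhabited I); last first.
  by rewrite dist0// => i; apply: nI.
exact: le_trans (le_dist x y i).
Qed.

Let distxx x : linf_dist x x = 0.
Proof.
apply/eqP; rewrite eq_le dist_ge0 andbT.
by apply: dist_le => // i; rewrite subrr normr0.
Qed.

Let dist_positivity x y : linf_dist x y = 0 -> x = y.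
Proof.
move=> xy0; have xy : linf_fun x = linf_fun y.
  apply/funext => i; apply/eqP; rewrite -subr_eq0 -normr_le0 -xy0.
  exact: le_dist.
case: x xy {xy0} => f hf /=; case: y => g hg /= fg.
by subst g; congr Linf; exact: Prop_irrelevance.
Qed.

Let dist_sym x y : linf_dist x y = linf_dist y x.
Proof.
rewrite /linf_dist; congr sup; congr image.
by apply/funext => i; rewrite distrC.
Qed.

Let dist_triangle y x z : linf_dist x z <= linf_dist x y + linf_dist y z.
Proof.
apply: dist_le => [|i]; first exact: addr_ge0.
apply: (le_trans (ler_distD (y i) _ _)).
by apply: lerD; exact: le_dist.
Qed.

HB.instance Definition _ := @isMetric.Build R (linf R I) linf_dist
  distxx dist_positivity dist_sym dist_triangle.

End linf_metric.

Section random_elements.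
Context (R : realType) {d : measure_display} {O : measurableType d}.
Variable Pr : probability O R.

Definition borel_measurable (D : metricType R) (G : O -> D) : Prop :=
  forall V : set D, open V -> measurable (G @^-1` V).

Definition tight (D : metricType R) (G : O -> D) : Prop :=
  forall e : R, 0 < e -> exists2 K : set D, compact K &
    ((1 - e)%:E <= Pr (G @^-1` K))%E.

(* normal_prob m 0 is not the point mass at m, so the degenerate normal law is
   treated separately. *)
Definition normal_law (m s : R) (A : set R) : \bar R :=
  if s == 0 then \d_m A else normal_prob m s A.

Definition gaussian_process (I : Type) (G : O -> linf R I) : Prop :=
  forall (k : nat) (t : 'I_k -> I) (a : 'I_k -> R),
  exists m s : R, forall A : set R, measurable A ->
    Pr [set o | A (\sum_(i < k) a i * G o (t i))] = normal_law m s A.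

End random_elements.

(* F is required to be a subset of L_2(P0), without which the covariance is
   undefined. *)
Definition brownian_bridge (R : realType) (dS : measure_display)
    (S : measurableType dS) (P0 : probability S R) (F : set (S -> R))
    (d : measure_display) (O : measurableType d) (Pr : probability O R)
    (G : O -> linf R F) : Prop :=
  [/\ forall f : F, \val f \in Lfun P0 2%:E,
      borel_measurable G /\ tight Pr G,
      gaussian_process Pr G,
      forall f : F, \int[Pr]_o G o f = 0
    & forall f g : F, \int[Pr]_o (G o f * G o g) =
        \int[P0]_y (\val f y * \val g y)
        - (\int[P0]_y \val f y) * (\int[P0]_y \val g y)].

(* The maps h : D -> [-1, 1] that are 1-Lipschitz. *)
Definition BL1 (R : realType) (D : metricType R) : set (D -> R) :=
  [set h | (forall z, `|h z| <= 1) /\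
           (forall z z', `|h z - h z'| <= mdist z z')].

(* The data (X_1, ..., X_n) are the coordinates of the product space of n-tuples
   under P0^n, which carries the outer probability and outer expectation; the
   bootstrap weights (W_n1, ..., W_nn) are the coordinates of n.-tuple (W n)
   under Q_n^n. *)
Section data.
Local Open Scope ereal_scope.
Context (R : realType) (dS : measure_display) (S : measurableType dS).
Variable P0 : probability S R.

(* P_0^* : the library's outer measure induced by P0^n. *)
Definition outer_P0 (n : nat) (A : set (n.-tuple S)) : \bar R :=
  ((iid_law P0 n)^*)%mu A.

(* Y_n -> 0 in P_0^*-outer probability. *)
Definition cvg0_outer (Y : forall n, n.-tuple S -> \bar R) : Prop :=
  forall e : R, (0 < e)%R ->
    outer_P0 [set x | e%:E <= `|Y n x|] @[n --> \oo] --> 0.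

(* Y_n = o_{P_0^*}(r_n). *)
Definition oP0 (Y : forall n, n.-tuple S -> \bar R) (r : nat -> R) : Prop :=
  cvg0_outer (fun n x => Y n x * ((r n)^-1)%:E).

(* Unconditional (Hoffmann-Jorgensen) weak convergence. *)
Definition weak_cvg (D : metricType R) (Gn : forall n, n.-tuple S -> D)
    (d : measure_display) (O : measurableType d) (Pr : probability O R)
    (G : O -> D) : Prop :=
  forall h : D -> R, continuous h -> (exists c : R, forall z, `|h z| <= c)%R ->
    outer_expectation (iid_law P0 n) (fun x => (h (Gn n x))%:E) @[n --> \oo]
      --> \int[Pr]_o (h (G o))%:E.

Context (dW : nat -> measure_display) (W : forall n, measurableType (dW n)).
Variable Q : forall n, probability (W n) R.

Definition outer_EW (n : nat) (h : n.-tuple S -> n.-tuple (W n) -> \bar R)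
    (x : n.-tuple S) : \bar R :=
  outer_expectation (iid_law (Q n) n) (h x).

Definition outer_PW (n : nat) (A : n.-tuple S -> set (n.-tuple (W n)))
    (x : n.-tuple S) : \bar R :=
  outer_prob (iid_law (Q n) n) (A x).

(* Y_n = o_{P_W^*}(r_n). *)
Definition oPW (Y : forall n, n.-tuple S -> n.-tuple (W n) -> \bar R)
    (r : nat -> R) : Prop :=
  forall e : R, (0 < e)%R -> cvg0_outer (fun n =>
    outer_PW (fun x => [set w | e%:E <= `|Y n x w * ((r n)^-1)%:E|])).

(* Weak convergence conditionally on the data in outer probability. *)
Definition cond_weak_cvg (D : metricType R)
    (Gn : forall n, n.-tuple S -> n.-tuple (W n) -> D)
    (d : measure_display) (O : measurableType d) (Pr : probability O R)
    (G : O -> D) : Prop :=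
  cvg0_outer (fun n x =>
    ereal_sup [set `| outer_EW (fun x w => (h (Gn n x w))%:E) x
                      - \int[Pr]_o (h (G o))%:E | | h in @BL1 R D]).

(* zeta_{n,p}^*, for psi_n^* a function of the data and the bootstrap weights;
   the infimum is taken in \bar R, so that inf set0 = +oo. *)
Definition boot_quantile (n : nat) (psis : n.-tuple S -> n.-tuple (W n) -> R)
    (p : R) (x : n.-tuple S) : \bar R :=
  ereal_inf [set z%:E | z in [set z : R |
    p%:E <= outer_PW (fun x => [set w | psis x w <= z]%R) x]].

(* An event "phi_n \in F" is said to hold with probability tending to one when
   the outer probability of its complement vanishes, i.e. when its inner
   probability tends to one. For a measurable event this is the same as its
   outer probability tending to one; for a nonmeasurable one the latter does not
   exclude that the complement also has outer probability one. *)
Definition donsker_cond (phi0 : S -> R) (phin : forall n, n.-tuple S -> S -> R)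
    : Prop :=
  exists F : set (S -> R),
  [/\ forall f, F f -> measurable_fun [set: S] f,
      F phi0,
      outer_P0 [set x | ~ F (phin n x)] @[n --> \oo] --> 0
    & exists Gn : forall n, n.-tuple S -> linf R F,
      exists (d : measure_display) (O : measurableType d)
             (Pr : probability O R) (G : O -> linf R F),
      [/\ forall n x (f : F),
            Gn n x f = scaled_diff n (empirical R x) P0 (\val f),
          brownian_bridge P0 Pr G
        & weak_cvg Gn Pr G]].

Variable g : forall n, {mfun (n.-tuple S * W n)%type >-> S}.

Definition boot_donsker_cond (phi0 : S -> R)
    (phis : forall n, n.-tuple S -> n.-tuple (W n) -> S -> R) : Prop :=
  exists F : set (S -> R),
  [/\ forall f, F f -> measurable_fun [set: S] f,
      F phi0,
      cvg0_outer (fun n => outer_PW (fun x => [set w | ~ F (phis n x w)]))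
    & exists Gn : forall n, n.-tuple S -> n.-tuple (W n) -> linf R F,
      exists (d : measure_display) (O : measurableType d)
             (Pr : probability O R) (G : O -> linf R F),
      [/\ forall n x (f : F), (0 < n)%N ->
            (resample_law (g n) (Q n) x).-integrable [set: S]
              (EFin \o \val f),
          forall n x w (f : F),
            Gn n x w f = scaled_diff n
              (empirical R (bootstrap_sample (g n) x w))
              (resample_law (g n) (Q n) x) (\val f),
          brownian_bridge P0 Pr G
        & cond_weak_cvg Gn Pr G]].

End data.

(* Main.v *)
From HB Require Import structures.
Require Import Defs.
From mathcomp Require Import all_boot all_order all_algebra.
From mathcomp Require Import finmap all_classical all_reals all_analysis.
From mathcomp Require Import measurable_realfun.
From mathcomp Require Import lra ring.

Import Order.TTheory GRing.Theory Num.Theory.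
Import numFieldNormedType.Exports.

Set Implicit Arguments.
Unset Strict Implicit.
Unset Printing Implicit Defensive.

Local Open Scope classical_set_scope.
Local Open Scope ring_scope.

(** Up to boundary effects, the interval covers [psi0] when the conditional
distribution function of the bootstrap estimator, read at [psi0], lies between
[beta] and [1 - alpha].  Let [F] be the distribution function of the normal law
[N(0, P0 phi0^2)], let [Y = G_n phi0], and let
[t = sqrt n (psi0 - T(eta_n, hatP_n))].

- Unconditionally, the remainder conditions and the asymptotic equicontinuity of
  [G_n] at [phi0] give [t = - Y + o(1)], and [Y] converges weakly to
  [N(0, P0 phi0^2)].
- Conditionally on the data, the same linearization applied to the bootstrap
  shows that the distribution function of [sqrt n] times the deviation of the
  bootstrap estimator from [T(eta_n, hatP_n)] is, with high probability,
  uniformly close to [F].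

Hence the interval covers [psi0] when [beta <= F(t) <= 1 - alpha], up to an
arbitrarily small change of both levels.  As [F] is Lipschitz and
[F(- y) = 1 - F(y)], this says [alpha <= F(Y) <= 1 - beta], and the limit of
its probability is the mass that the uniform law gives to the interval from
[alpha] to [1 - beta].
The symmetry of the normal law is what makes the percentile interval valid: the
bootstrap errors are read with the sign opposite to that of the sampling errors.

Asymptotic equicontinuity ([donsker_linearization] and
[bootstrap_linearization]) is needed only at the fixed index [phi0], and this
permits an elementary proof ([bridge_equicontinuity]).  By tightness the bridge
lies in a compact set up to small probability, and finitely many balls of small
radius cover this compact set.  If the centre of a ball oscillates near [phi0]
along a sequence that converges to [phi0] in L2, then on the event that the
bridge lies in the ball its own increments along this sequence stay bounded
away from zero, while their second moments vanish; so the ball has probability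
zero.  The other finitely many centres are almost continuous at [phi0], and so
is the bridge, uniformly over a common L2-neighbourhood.  A single bounded
Lipschitz function of the modulus of continuity ([modulus_test]) transfers this
to [G_n] and to its bootstrap version.

The two limiting bridges may live on different probability spaces, so their
marginals at [phi0] are identified by their moments.  The normal law with
parameters [m] and [s] has mean [m] and variance [s ^+ 2] times the second
moment of the standard normal law; mean zero and variance [P0 phi0^2] therefore
determine the law.

None of the estimators is assumed measurable.  All probabilities are handled as
outer measures, through subadditivity, monotonicity and a Markov inequality for
outer expectations, and [whp] collects the events whose complements have
vanishing outer probability. *)

(** * Moments and symmetry of the normal law *)

Section normal.
Context {R : realType}.
Notation mu := (@lebesgue_measure R).
Implicit Types (m s : R).

(** Both the Radon-Nikodym derivative of the normal law and [normal_pdf] have the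
same integrals over measurable sets, so they agree almost everywhere. *)
Lemma ge0_integral_normal_prob m s (f : R -> \bar R) :
  measurable_fun [set: R] f -> (forall x, (0 <= f x)%E) ->
  (\int[normal_prob m s]_x f x = \int[mu]_x (f x * (normal_pdf m s x)%:E))%E.
Proof.
move=> mf f0.
rewrite -(Radon_Nikodym_SigmaFinite.change_of_variables
  (normal_prob_dominates m s))//.
have iRN := Radon_Nikodym_SigmaFinite.f_integrable (normal_prob_dominates m s).
apply: ae_eq_integral => //.
- by apply: emeasurable_funM => //; exact: measurable_int iRN.
- apply: emeasurable_funM => //; apply/measurable_EFinP.
  exact: measurable_normal_pdf.
- apply: ae_eqe_mul2l; apply: integral_ae_eq => //.
  + by apply/measurable_EFinP; exact: measurable_normal_pdf.
  + move=> A _ mA.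
    by rewrite -(Radon_Nikodym_SigmaFinite.f_integral (normal_prob_dominates m s)).
Qed.

Lemma normal_prob_sqr m s t : s ^+ 2 = t ^+ 2 ->
  normal_prob m s = normal_prob m t.
Proof.
move=> st; apply/funext => A; congr (integral _ _ _); apply/funext => x.
rewrite /normal_pdf /normal_peak /normal_fun st.
by rewrite -(sqrf_eq0 s) -(sqrf_eq0 t) st.
Qed.

Lemma normal_pdf_scale m s x : 0 < s ->
  normal_pdf m s (s * x + m) * s = normal_pdf 0 1 x.
Proof.
move=> s0; rewrite !normal_pdfE ?gt_eqF//.
rewrite /normal_fun addrK subr0 expr1n mulrAC; congr (_ * expR _).
- rewrite /normal_peak -mulrnAr sqrtrM ?sqr_ge0// sqrtr_sqr gtr0_norm//.
  by rewrite invfM mulrAC mulVf ?gt_eqF// mul1r expr1n mul1r.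
- rewrite exprMn; field; exact: lt0r_neq0.
Qed.

Lemma derive1_affine m s : (fun x : R => s * x + m)^`()%classic = cst s.
Proof.
apply/funext => x; rewrite derive1E deriveD// derive_cst addr0.
by rewrite deriveM// derive_cst scaler0 addr0 derive_id/= scaler1.
Qed.

(** The substitution [y = s * x + m] turns the density of parameters [m] and [s]
into the standard one, by [normal_pdf_scale]. *)
Lemma ge0_normal_prob_standardize m s (h : R -> R) : 0 < s ->
  continuous h -> (forall x, 0 <= h x) ->
  (\int[normal_prob m s]_x (h x)%:E =
   \int[normal_prob 0 1]_x (h (s * x + m))%:E)%E.
Proof.
move=> s0 ch h0.
rewrite ge0_integral_normal_prob; last 2 first.
- by apply/measurable_EFinP; exact: continuous_measurable_fun.
- by move=> x; rewrite lee_fin.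
rewrite ge0_integral_normal_prob; last 2 first.
- apply/measurable_EFinP/measurableT_comp; first exact: continuous_measurable_fun.
  by apply: measurable_funD => //; exact: measurable_funM.
- by move=> x; rewrite lee_fin.
under eq_integral do rewrite -EFinM.
have sneq0 : s != 0 by rewrite gt_eqF.
rewrite (increasing_ge0_integration_by_substitutionT
  (F := fun x => s * x + m) (G := fun x => h x * normal_pdf m s x)).
- apply: eq_integral => x _; rewrite derive1_affine; congr (_%:E).
  change (h (s * x + m) * normal_pdf m s (s * x + m) * s = h (s * x + m) * normal_pdf 0 1 x).
  by rewrite -mulrA normal_pdf_scale.
- by move=> x y xy; rewrite ltrD2r ltr_pM2l.
- by rewrite derive1_affine => x; exact: cvg_cst.
- by rewrite derive1_affine; exact: is_cvg_cst.
- by rewrite derive1_affine; exact: is_cvg_cst.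
- by move=> x; apply: derivableD => //; exact: derivableM.
- apply: (cvg_comp (fun x => s * x) (fun x => x + m)); last exact: cvg_addrr_Ny.
  exact: gt0_cvgMrNy.
- apply: (cvg_comp (fun x => s * x) (fun x => x + m)); last exact: cvg_addrr.
  exact: gt0_cvgMry.
- move=> x; apply: cvgM; [exact: ch|exact: continuous_normal_pdf].
- by move=> x; rewrite mulr_ge0// normal_pdf_ge0.
Qed.

Lemma EFin_funepos T (f : T -> R) :
  ((fun x => (f x)%:E)^\+ = (fun x => (Num.max (f x) 0)%:E))%E.
Proof. by apply/funext => x; rewrite funeposE EFin_max. Qed.

Lemma EFin_funeneg T (f : T -> R) :
  ((fun x => (f x)%:E)^\- = (fun x => (Num.max (- f x) 0)%:E))%E.
Proof. by apply/funext => x; rewrite funenegE -EFinN EFin_max. Qed.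

Lemma normal_prob_standardize m s (f : R -> R) : 0 < s -> continuous f ->
  (\int[normal_prob m s]_x (f x)%:E =
   \int[normal_prob 0 1]_x (f (s * x + m))%:E)%E.
Proof.
move=> s0 cf; rewrite integralE [RHS]integralE !EFin_funepos !EFin_funeneg.
rewrite (ge0_normal_prob_standardize _ (h := fun x => Num.max (f x) 0) s0); last 2 first.
- move=> x; apply: (@continuous_max _ _ f (cst 0)); [exact: cf|exact: cvg_cst].
- by move=> x; rewrite le_max lexx orbT.
rewrite (ge0_normal_prob_standardize _ (h := fun x => Num.max (- f x) 0) s0).
- by [].
- move=> x; apply: (@continuous_max _ _ (fun x => - f x) (cst 0)).
  + by apply: continuousN; exact: cf.
  + exact: cvg_cst.
- by move=> x; rewrite le_max lexx orbT.
Qed.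

Lemma normal_pdf_even s x : s != 0 ->
  normal_pdf 0 s (- x) = normal_pdf 0 s x.
Proof. by move=> s0; rewrite !normal_pdfE// /normal_fun !subr0 sqrrN. Qed.

Lemma normal_prob_symmetric s a : s != 0 ->
  normal_prob 0 s `]-oo, a] = normal_prob 0 s `[- a, +oo[.
Proof.
move=> s0; rewrite /normal_prob -[in LHS](opprK a).
rewrite ge0_integration_by_substitutionNy.
- by apply: eq_integral => x _ /=; rewrite normal_pdf_even.
- by apply: continuous_subspaceT; exact: continuous_normal_pdf.
- by move=> x _; exact: normal_pdf_ge0.
Qed.

(** A polynomial factor is absorbed by widening the bell: since
[u <= expR u] at [u = 3 * x ^+ 2 / 8], the integrand [x ^+ 2 * normal_pdf 0 1 x]
is at most a constant multiple of [normal_pdf 0 2 x]. *)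
Lemma integral_sqr_std_normal_lty :
  (\int[normal_prob 0 1]_x (x ^+ 2)%:E < +oo :> \bar R)%E.
Proof.
rewrite ge0_integral_normal_prob; last 2 first.
- by apply/measurable_EFinP; exact: measurable_funX.
- by move=> x; rewrite lee_fin sqr_ge0.
pose c : R := 8%:R / 3%:R * normal_peak 1 / normal_peak 2.
have p2 : 0 < normal_peak 2 :> R by rewrite normal_peak_gt0.
have p1 : 0 < normal_peak 1 :> R by rewrite normal_peak_gt0.
have c0 : 0 <= c by rewrite divr_ge0 ?mulr_ge0// ltW.
apply: (@le_lt_trans _ _ (\int[mu]_x (c%:E * (normal_pdf 0 2 x)%:E))%E).
  apply: ge0_le_integral => //.
  - by move=> x _; rewrite mule_ge0// lee_fin ?sqr_ge0// normal_pdf_ge0.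
  - apply/measurable_EFinP; apply: measurable_funM; first exact: measurable_funX.
    exact: measurable_normal_pdf.
  - apply/measurable_EFinP; apply: measurable_funM => //.
    exact: measurable_normal_pdf.
  move=> x _; rewrite -!EFinM lee_fin !normal_pdfE//.
  rewrite /normal_fun subr0 expr1n.
  set B := expR (- x ^+ 2 / (2 ^+ 2 *+ 2)).
  have -> : c * (normal_peak 2 * B) = normal_peak 1 * (8 / 3 * B).
    by rewrite /c; field; rewrite gt_eqF.
  rewrite mulrCA ler_pM2l//.
  have -> : - x ^+ 2 / (1 *+ 2) = - (3 * x ^+ 2 / 8) + (- x ^+ 2 / (2 ^+ 2 *+ 2)).
    by field.
  rewrite expRD -/B mulrA ler_wpM2r ?expR_ge0//.
  rewrite expRN -ler_pdivlMr ?invr_gt0 ?expR_gt0// invrK.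
  have := expR_ge1Dx (3 * x ^+ 2 / 8).
  nra.
rewrite integralZl//; last exact: integrable_normal_pdf.
by rewrite integral_normal_pdf mule1 ltry.
Qed.

End normal.

Lemma integral_probability_cst (R : realType) d (O : measurableType d)
  (P : probability O R) (c : R) : (\int[P]_x c%:E = c%:E)%E.
Proof. by rewrite integral_cst//= probability_setT mule1. Qed.

Section normal_moments.
Context {R : realType}.
Implicit Types (m s : R).

Notation std := (normal_prob (0 : R) 1).

Lemma std_normal_integrable_sqr :
  std.-integrable [set: R] (fun x => (x ^+ 2)%:E).
Proof.
apply/integrableP; split; first by apply/measurable_EFinP; exact: measurable_funX.
under eq_integral do rewrite /= ger0_norm ?sqr_ge0//.
exact: integral_sqr_std_normal_lty.
Qed.

Lemma integrable_sqr d (O : measurableType d) (P : probability O R) (f : O -> R) :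
  measurable_fun [set: O] f -> P.-integrable [set: O] (fun x => (f x ^+ 2)%:E) ->
  P.-integrable [set: O] (fun x => (f x)%:E).
Proof.
move=> mf if2.
apply: (@le_integrable _ _ _ P _ measurableT _ (fun x => (1 + f x ^+ 2)%:E)).
- exact/measurable_EFinP.
- move=> x _; rewrite /= lee_fin; apply: le_trans (ler_norm _).
  rewrite -[f x ^+ 2]real_normK ?num_real//.
  have := sqr_ge0 (`|f x| - 1); have := normr_ge0 (f x); nra.
- under eq_fun do rewrite EFinD.
  apply: integrableD => //.
  exact: finite_measure_integrable_cst.
Qed.

Lemma std_normal_integrable : std.-integrable [set: R] (fun x => x%:E).
Proof. by apply: integrable_sqr => //; exact: std_normal_integrable_sqr. Qed.

(** The reflection [x |-> - x] exchanges the integrals of the positive and of the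
negative part. *)
Lemma integral_std_normal : (\int[std]_x x%:E = 0 :> \bar R)%E.
Proof.
rewrite integralE.
suff -> : (\int[std]_x (fun y : R => y%:E)^\- x = \int[std]_x (fun y : R => y%:E)^\+ x :> \bar R)%E.
  rewrite subee// ge0_fin_numE.
    exact: integral_funepos_lt_pinfty std_normal_integrable.
  by apply: integral_ge0 => x _; rewrite funepos_ge0.
rewrite EFin_funepos EFin_funeneg.
have mmax (f : R -> R) : measurable_fun setT f ->
    measurable_fun setT (fun x => (Num.max (f x) 0)%:E).
  by move=> mf; apply/measurable_EFinP; exact: measurable_maxr.
rewrite ge0_integral_normal_prob; last 2 first.
- by apply: (mmax (fun x => - x)); exact: measurableT_comp.
- by move=> x; rewrite lee_fin le_max lexx orbT.
rewrite ge0_integral_normal_prob; last 2 first.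
- exact: (mmax (fun x => x)).
- by move=> x; rewrite lee_fin le_max lexx orbT.
pose f (x : R) := Num.max (- x) 0 * normal_pdf 0 1 x.
transitivity (\int[@lebesgue_measure R]_(x in `]-oo, (- 0)%R]) (f x)%:E)%E.
  rewrite [RHS]integral_mkcond; apply: eq_integral => x _.
  rewrite patchE mem_setE in_itv/= oppr0; case: ifPn => //.
  rewrite -ltNge => x0; rewrite max_r; last by rewrite oppr_le0 ltW.
  by rewrite mul0e.
rewrite ge0_integration_by_substitutionNy; last 2 first.
- apply: continuous_subspaceT => x; apply: cvgM; last exact: continuous_normal_pdf.
  apply: (@continuous_max _ _ (fun x : R => - x) (cst 0)).
  + by apply: continuousN; exact: cvg_id.
  + exact: cvg_cst.
- by move=> x _; rewrite mulr_ge0 ?normal_pdf_ge0// le_max lexx orbT.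
rewrite [LHS]integral_mkcond; apply: eq_integral => x _.
rewrite patchE mem_setE in_itv/= andbT /f opprK.
rewrite normal_pdf_even ?oner_eq0//.
case: ifPn; first by rewrite EFinM.
rewrite -ltNge => x0; rewrite max_r; last by rewrite ltW.
by rewrite mul0e.
Qed.

(** The value is 1; what identifies a normal law by its variance is that it depends
neither on [m] nor on [s]. *)
Definition std_normal_sqr : R := fine (\int[std]_x (x ^+ 2)%:E)%E.

Lemma normal_prob_abs m s : normal_prob m s = normal_prob m `|s|.
Proof. by apply: normal_prob_sqr; rewrite real_normK ?num_real. Qed.

Lemma integral_normal_prob m s : s != 0 ->
  (\int[normal_prob m s]_x x%:E = m%:E)%E.
Proof.
move=> s0; rewrite normal_prob_abs.
rewrite (normal_prob_standardize _ (f := fun x => x)); last 2 first.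
- by rewrite normr_gt0.
- by move=> x; exact: cvg_id.
under eq_integral do rewrite EFinD EFinM.
rewrite integralD//=; last 2 first.
- by apply: integrableZl => //; exact: std_normal_integrable.
- exact: (finite_measure_integrable_cst std).
rewrite integralZl//; last exact: std_normal_integrable.
rewrite integral_std_normal mule0 add0e.
by rewrite integral_probability_cst.
Qed.

Lemma integral_sqr_normal_prob m s : s != 0 ->
  (\int[normal_prob m s]_x (x ^+ 2)%:E = (s ^+ 2 * std_normal_sqr + m ^+ 2)%:E)%E.
Proof.
move=> s0; rewrite normal_prob_abs.
rewrite (normal_prob_standardize _ (f := fun x => x ^+ 2)); last 2 first.
- by rewrite normr_gt0.
- exact: exprn_continuous.
have E x : (((`|s| * x + m) ^+ 2)%:E =
    (s ^+ 2)%:E * (x ^+ 2)%:E + ((`|s| * m *+ 2)%:E * x%:E + (m ^+ 2)%:E))%E.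
  rewrite -!EFinM -!EFinD; congr (_%:E).
  rewrite -(real_normK (num_real s)); ring.
under eq_integral do rewrite E.
have i2 := std_normal_integrable_sqr.
have i1 := std_normal_integrable.
have i0 := finite_measure_integrable_cst std (m ^+ 2).
rewrite integralD//=; last 2 first.
- exact: integrableZl.
- by apply: integrableD; [|exact: integrableZl|exact: i0].
rewrite integralD//=; [|exact: integrableZl|exact: i0].
rewrite integralZl// integralZl// integral_std_normal mule0 add0e.
rewrite integral_probability_cst.
rewrite [RHS]EFinD [in RHS](EFinM (s ^+ 2)) /std_normal_sqr fineK//.
rewrite ge0_fin_numE; first exact: integral_sqr_std_normal_lty.
by apply: integral_ge0 => x _; rewrite lee_fin sqr_ge0.
Qed.

(** The density is bounded by its peak; this yields a Lipschitz distribution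
function. *)
Lemma normal_prob_itv_le m s a b : s != 0 -> a <= b ->
  (normal_prob m s `]a, b] <= (normal_peak s * (b - a))%:E)%E.
Proof.
move=> s0 ab; rewrite /normal_prob.
apply: (@le_trans _ _ (\int[@lebesgue_measure R]_(x in `]a, b]) (normal_peak s)%:E)%E).
  apply: ge0_le_integral => //.
  - by move=> x _; rewrite lee_fin normal_pdf_ge0.
  - apply/measurable_EFinP; apply: measurable_funTS; exact: measurable_normal_pdf.
  - by move=> x _; rewrite lee_fin normal_pdf_ub.
rewrite integral_cst//= lebesgue_measure_itv/= lte_fin.
case: ltP => [_|ba]; first by rewrite -EFinB -EFinM.
by rewrite mule0 lee_fin mulr_ge0 ?normal_peak_ge0// subr_ge0.
Qed.

End normal_moments.

(** [normal_law] treats the degenerate case separately, so each moment formula is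
obtained once from the point mass and once from the density. *)
Section normal_law.
Context (R : realType) d (O : measurableType d) (Pr : probability O R).
Variables (Z : O -> R) (m s : R).
Hypothesis mZ : measurable_fun [set: O] Z.
Hypothesis ZE : forall A : set R, measurable A -> Pr [set o | A (Z o)] = normal_law m s A.

Let mZ' : @measurable_fun _ _ O (measurableTypeR R) [set: O] Z.
Proof. exact: mZ. Qed.

Let X : {mfun O >-> measurableTypeR R} :=
  @mfun_Sub _ _ O (measurableTypeR R) Z (mem_set mZ').

Let s0_law (f : R -> \bar R) : s = 0 -> measurable_fun [set: R] f ->
  (\int[distribution Pr X]_x f x = f m)%E.
Proof.
move=> s0 mf; transitivity (\int[@dirac _ (measurableTypeR R) m R]_x f x)%E.
  apply: (@eq_measure_integral _ (measurableTypeR R) _ _ (@dirac _ (measurableTypeR R) m R) (distribution Pr X)) => A mA _.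
  by have := ZE mA; rewrite /normal_law s0 eqxx.
by rewrite integral_dirac// diracT mul1e.
Qed.

Let s1_law (f : R -> \bar R) : s != 0 ->
  (\int[distribution Pr X]_x f x = \int[normal_prob m s]_x f x)%E.
Proof.
move=> s0.
apply: (@eq_measure_integral _ (measurableTypeR R) _ _ (normal_prob m s) (distribution Pr X)) => A mA _.
by have := ZE mA; rewrite /normal_law (negbTE s0).
Qed.

Let integral_sqr_law :
  (\int[distribution Pr X]_x (x ^+ 2)%:E = (s ^+ 2 * std_normal_sqr + m ^+ 2)%:E)%E.
Proof.
have [s0|s0] := eqVneq s 0; last by rewrite s1_law// integral_sqr_normal_prob.
rewrite s0_law//; first by rewrite s0 expr0n mul0r add0r.
by apply/measurable_EFinP; exact: measurable_funX.
Qed.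

Let integral_law : (\int[distribution Pr X]_x x%:E = m%:E)%E.
Proof.
have [s0|s0] := eqVneq s 0; last by rewrite s1_law// integral_normal_prob.
by rewrite s0_law//; apply/measurable_EFinP.
Qed.

Lemma normal_law_integral_sqr :
  (\int[Pr]_o (Z o ^+ 2)%:E = (s ^+ 2 * std_normal_sqr + m ^+ 2)%:E)%E.
Proof.
rewrite -integral_sqr_law ge0_integral_distribution//.
- by apply/measurable_EFinP; exact: measurable_funX.
- by move=> x; rewrite lee_fin sqr_ge0.
Qed.

Lemma normal_law_integrable_sqr :
  Pr.-integrable [set: O] (fun o => (Z o ^+ 2)%:E).
Proof.
apply/integrableP; split; first by apply/measurable_EFinP; exact: measurable_funX.
under eq_integral do rewrite /= ger0_norm ?sqr_ge0//.
by rewrite normal_law_integral_sqr ltry.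
Qed.

Lemma normal_law_integral : (\int[Pr]_o (Z o)%:E = m%:E)%E.
Proof.
rewrite -integral_law integral_distribution//.
by apply: (integrable_sqr (f := Z)) => //; exact: normal_law_integrable_sqr.
Qed.

End normal_law.

(** * The centred normal distribution function *)

Section normal_cdf.
Context (R : realType) (s : R).
Hypothesis s0 : s != 0.

Definition normal_cdf (y : R) : R := fine (normal_prob 0 s `]-oo, y]).

Let fin (A : set R) : measurable A -> normal_prob 0 s A \is a fin_num.
Proof. by move=> mA; exact: fin_num_measure. Qed.

Lemma normal_cdfE y : normal_prob 0 s `]-oo, y] = (normal_cdf y)%:E.
Proof. by rewrite fineK// fin. Qed.

Lemma normal_cdf_itv a b : a <= b ->
  normal_prob 0 s `]a, b] = (normal_cdf b - normal_cdf a)%:E.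
Proof.
move=> ab; rewrite EFinB -!normal_cdfE.
rewrite (_ : `]-oo, b]%classic = `]-oo, a] `|` `]a, b]); last first.
  apply/seteqP; split=> x /=; rewrite !in_itv/=.
    by move=> xb; case: (leP x a) => xa; [left|right].
  by case=> [/le_trans|/andP[]//]; apply.
rewrite [X in (X - _)%E]measureU//; first by rewrite addeAC subee ?add0e// fin.
rewrite -subset0 => x [/=]; rewrite !in_itv/= => xa /andP[ax _].
by move: xa; rewrite leNgt ax.
Qed.

Lemma normal_cdfB a b : a <= b ->
  0 <= normal_cdf b - normal_cdf a <= normal_peak s * (b - a).
Proof.
move=> ab; have := normal_prob_itv_le 0 s0 ab.
have : (0 <= normal_prob 0 s `]a, b])%E by exact: measure_ge0.
by rewrite normal_cdf_itv// !lee_fin => -> ->.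
Qed.

Lemma normal_cdf_nondecreasing a b : a <= b -> normal_cdf a <= normal_cdf b.
Proof. by move=> /normal_cdfB/andP[]; rewrite subr_ge0. Qed.

(** Symmetry gives the mass of the closed half-line; the density does not charge
its end point, and the open half-line is the complement of a lower one. *)
Lemma normal_cdfN y : normal_cdf (- y) = 1 - normal_cdf y.
Proof.
apply: EFin_inj; rewrite EFinB -!normal_cdfE normal_prob_symmetric// opprK.
rewrite (_ : normal_prob 0 s `[y, +oo[ = normal_prob 0 s `]y, +oo[); last first.
  rewrite /normal_prob integral_itv_obnd_cbnd//.
  by apply/measurable_EFinP; apply: measurable_funTS; exact: measurable_normal_pdf.
by rewrite -(@probability_setC _ _ _ (normal_prob 0 s))// setCitvl.
Qed.

Lemma normal_cdf_continuous : continuous normal_cdf.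
Proof.
move=> y; apply/cvgrPdist_le => e e0.
have p0 : 0 < normal_peak s by exact: normal_peak_gt0.
have := nbhsx_ballx y (e / normal_peak s) (divr_gt0 e0 p0).
apply: filterS => z; rewrite /ball/= ltr_pdivlMr// mulrC => yz.
apply: le_trans (ltW yz).
wlog : y z {yz} / y <= z => [hw|yz].
  by case: (leP y z) => [|/ltW] h; [exact: hw|rewrite distrC (distrC y); exact: hw].
by have := normal_cdfB yz; rewrite distrC (distrC y) => /andP[h1 h2];
  rewrite !ger0_norm// subr_ge0.
Qed.

(** Intermediate values: the distribution function is continuous and has limits 0
and 1. *)
Lemma normal_cdf_quantile p : 0 < p < 1 -> exists y, normal_cdf y = p.
Proof.
move=> /andP[p0 p1].
pose P : probability (measurableTypeR R) R := normal_prob 0 s.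
have mX : @measurable_fun _ _ (measurableTypeR R) R setT idfun by exact: measurable_id.
pose X : {RV P >-> R} := @mfun_Sub _ _ (measurableTypeR R) R idfun (mem_set mX).
have XE y : cdf X y = (normal_cdf y)%:E by rewrite -normal_cdfE.
have [a ap] : exists a, normal_cdf a <= p.
  apply: contrapT => /forallNP h; move: p0; apply/negP; rewrite -leNgt -lee_fin.
  apply: cvge_to_ge (cvg_cdfNy0 X) _; apply: nearW => y; rewrite XE lee_fin.
  by apply: ltW; rewrite ltNge; exact/negP.
have [b pb] : exists b, p <= normal_cdf b.
  apply: contrapT => /forallNP h; move: p1; apply/negP; rewrite -leNgt -lee_fin.
  apply: cvge_to_le (cvg_cdfy1 X) _; apply: nearW => y; rewrite XE lee_fin.
  by apply: ltW; rewrite ltNge; exact/negP.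
have [ab|/ltW ba] := leP a b.
  have cF : {within `[a, b], continuous normal_cdf}.
    by apply: continuous_subspaceT; exact: normal_cdf_continuous.
  have abp : Num.min (normal_cdf a) (normal_cdf b) <= p
             <= Num.max (normal_cdf a) (normal_cdf b).
    by rewrite ge_min ap le_max pb orbT.
  by have [y _ yp] := IVT ab cF abp; exists y.
by exists a; apply/le_anti; rewrite ap (le_trans pb)// normal_cdf_nondecreasing.
Qed.

End normal_cdf.

Section normal_cdf_modulus.
Context (R : realType) (s : R).
Hypothesis s0 : s != 0.
Let F := normal_cdf s.
Let C := normal_peak s.

Lemma normal_cdf_dist a b : `|F a - F b| <= C * `|a - b|.
Proof.
wlog ab : a b / a <= b => [hw|].
  by case: (leP a b) => [|/ltW] h; [exact: hw|rewrite distrC (distrC a); exact: hw].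
have /andP[h1 h2] := normal_cdfB s0 ab.
by rewrite distrC (distrC a) (ger0_norm h1) ger0_norm// subr_ge0.
Qed.

Lemma normal_cdf_shift a b e k : C * k <= e -> `|a - b| <= k ->
  F b - e <= F a <= F b + e.
Proof.
move=> Ck abk; have := normal_cdf_dist a b.
have : C * `|a - b| <= e by apply: le_trans Ck; rewrite ler_wpM2l// normal_peak_ge0.
rewrite ler_norml; lra.
Qed.

End normal_cdf_modulus.

(** A centred normal law is determined by its variance.  As the variance [V] is
positive, it forces the unspecified constant [std_normal_sqr] to be nonzero. *)
Lemma normal_law_of_variance (R : realType) (s s' : R) (V : R) : 0 < V ->
  s ^+ 2 * std_normal_sqr = V -> s' ^+ 2 * std_normal_sqr = V ->
  s != 0 /\ normal_law 0 s' = normal_prob 0 s.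
Proof.
move=> V0 sV s'V.
have c0 : @std_normal_sqr R != 0.
  by apply: contraTneq V0 => c0; rewrite -sV c0 mulr0 ltxx.
have ss' : s' ^+ 2 = s ^+ 2 by apply: (mulIf c0); rewrite sV.
have s0 : s != 0 by apply: contraTneq V0 => s0; rewrite -sV s0 expr0n mul0r ltxx.
have s'0 : s' != 0 by rewrite -sqrf_eq0 ss' sqrf_eq0.
split => //; apply/funext => A; rewrite /normal_law (negbTE s'0).
by rewrite (normal_prob_sqr 0 ss').
Qed.

(** * Maps on the space of bounded functions *)

Lemma lipschitz1_continuous (R : realType) (D : metricType R) (h : D -> R) :
  (forall z z', `|h z - h z'| <= mdist z z') -> continuous h.
Proof.
move=> hL z; apply/cvgrPdist_lt => e e0.
have := nbhsx_ballx z e e0; rewrite ballEmdist; apply: filterS => z' /= zz'.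
exact: le_lt_trans (hL z z') zz'.
Qed.

Lemma linf_eval_lipschitz (R : realType) (I : Type) (i : I) (x y : linf R I) :
  `|x i - y i| <= mdist x y.
Proof.
have [a xa] := linf_bounded x; have [b yb] := linf_bounded y.
apply: ub_le_sup; last by exists i.
exists (a + b) => _ [j _ <-]; apply: (le_trans (ler_normB _ _)).
by apply: lerD; [apply: xa|apply: yb]; exists j.
Qed.

Lemma borel_measurable_comp (R : realType) d (O : measurableType d)
    (D : metricType R) (G : O -> D) (h : D -> R) :
  borel_measurable G -> continuous h -> measurable_fun [set: O] (h \o G).
Proof.
move=> mG ch; apply: (measurability _ (RGenOpens.measurableE R)).
move=> _ [_ [a [b ->] <-]]; rewrite setTI comp_preimage; apply: mG.
move/continuousP : ch; apply; exact: interval_open.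
Qed.

(** A nonempty compact set provides the base point that [compact_cover] asks
for. *)
Lemma compact_finite_cover (T : topologicalType) (A : set T) :
  compact A -> cover_compact A.
Proof.
have [->|/set0P[x0 Ax0]] := eqVneq A set0.
  by move=> _ I D f _ _; exists fset0 => //; exact: sub0set.
pose T' : ptopologicalType := HB.pack T (isPointed.Build T x0).
move=> cA; have := compact_cover T' => e.
by move: cA; rewrite -[compact A]/(@compact T' A) e.
Qed.

(** * Brownian bridges: marginals, increments and continuity at a point *)

Section brownian_bridge.
Context (R : realType) dS (S : measurableType dS) (P0 : probability S R)
  (F : set (S -> R)) d (O : measurableType d) (Pr : probability O R)
  (G : O -> linf R F).
Hypothesis bb : brownian_bridge P0 Pr G.

Lemma bridge_measurable (f : F) : measurable_fun [set: O] (fun o => G o f).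
Proof.
have [_ [mG _] _ _ _] := bb.
apply: (borel_measurable_comp (h := fun z : linf R F => z f) mG).
apply: lipschitz1_continuous => z z'; exact: linf_eval_lipschitz.
Qed.

Lemma bridge_marginal (f : F) : exists m s : R, forall A : set R,
  measurable A -> Pr [set o | A (G o f)] = normal_law m s A.
Proof.
have [_ _ /(_ 1%N (fun=> f) (fun=> 1))[m [s ms]] _ _] := bb.
exists m, s => A mA; rewrite -ms//; congr (Pr _); apply/seteqP.
by split => o /=; rewrite big_ord1 mul1r.
Qed.

Lemma bridge_integrable_sqr (f : F) :
  Pr.-integrable [set: O] (fun o => (G o f ^+ 2)%:E).
Proof.
have [m [s ms]] := bridge_marginal f.
exact: (normal_law_integrable_sqr (bridge_measurable f) ms).
Qed.

(** The mean and the covariance of the bridge pin down the parameters of the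
marginal law. *)
Lemma bridge_marginal_centered (f : F) : exists s : R,
  (forall A : set R, measurable A -> Pr [set o | A (G o f)] = normal_law 0 s A) /\
  s ^+ 2 * std_normal_sqr =
  \int[P0]_y (\val f y ^+ 2) - (\int[P0]_y \val f y) ^+ 2.
Proof.
have [m [s ms]] := bridge_marginal f.
have [_ _ _ /(_ f) mean0 /(_ f f) cov] := bb.
have m0 : m = 0.
  have := normal_law_integral (bridge_measurable f) ms.
  by move: mean0; rewrite /Rintegral => + e; rewrite e.
subst m; exists s; split => //.
have := normal_law_integral_sqr (bridge_measurable f) ms.
rewrite expr0n addr0 => e; rewrite [RHS](_ : _ = \int[Pr]_o (G o f * G o f)).
  by rewrite /Rintegral e.
by rewrite cov.
Qed.

End brownian_bridge.

Section square_integrable.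
Context (R : realType) d (O : measurableType d) (P : probability O R).
Variables (f g : O -> R).
Hypotheses (mf : measurable_fun [set: O] f) (mg : measurable_fun [set: O] g).
Hypotheses (if2 : P.-integrable [set: O] (fun x => (f x ^+ 2)%:E))
           (ig2 : P.-integrable [set: O] (fun x => (g x ^+ 2)%:E)).

Lemma integrable_mul_sqr : P.-integrable [set: O] (fun x => (f x * g x)%:E).
Proof.
apply: (@le_integrable _ _ _ P _ measurableT _ (fun x => (f x ^+ 2 + g x ^+ 2)%:E)).
- by apply/measurable_EFinP; exact: measurable_funM.
- move=> x _; rewrite /= lee_fin; apply: le_trans (ler_norm _).
  rewrite normrM -(real_normK (num_real (f x))) -(real_normK (num_real (g x))).
  by have := sqr_ge0 (`|f x| - `|g x|); have := sqr_ge0 (`|f x| + `|g x|); nra.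
- under eq_fun do rewrite EFinD.
  exact: integrableD.
Qed.

Lemma integrable_sqrB : P.-integrable [set: O] (fun x => ((f x - g x) ^+ 2)%:E).
Proof.
apply: (@le_integrable _ _ _ P _ measurableT _
    (fun x => (f x ^+ 2 + f x ^+ 2 + (g x ^+ 2 + g x ^+ 2))%:E)).
- by apply/measurable_EFinP; apply: measurable_funX; exact: measurable_funB.
- move=> x _; rewrite /= lee_fin ger0_norm ?sqr_ge0//.
  apply: le_trans (ler_norm _).
  by have := sqr_ge0 (f x + g x); nra.
- under eq_fun do rewrite !EFinD.
  by apply: integrableD => //; exact: integrableD.
Qed.

Lemma Rintegral_sqrB : \int[P]_x ((f x - g x) ^+ 2) =
  \int[P]_x (f x ^+ 2) - 2 * \int[P]_x (f x * g x) + \int[P]_x (g x ^+ 2).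
Proof.
have ifg := integrable_mul_sqr.
have i2 : P.-integrable [set: O] (fun x => (2 * (f x * g x))%:E).
  by under eq_fun do rewrite EFinM; exact: integrableZl.
have i3 : P.-integrable [set: O] (fun x => (f x ^+ 2 - 2 * (f x * g x))%:E).
  by under eq_fun do rewrite EFinB; exact: integrableB.
rewrite -RintegralZl// -RintegralB// -RintegralD//.
by apply: eq_Rintegral => x _; ring.
Qed.

End square_integrable.

Lemma Lfun2P (R : realType) d (O : measurableType d) (P : probability O R) (f : O -> R) :
  f \in Lfun P 2%:E -> measurable_fun [set: O] f /\
    P.-integrable [set: O] (fun x => (f x ^+ 2)%:E).
Proof.
move=> Lf; split; last exact: Lfun2_integrable_sqr.
by move: Lf; rewrite inE => /andP[/[!inE]].
Qed.

Lemma Lnorm2_lt (R : realType) d (O : measurableType d) (P : probability O R)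
    (f : O -> R) (c : R) : 0 < c ->
  ('N[P]_2%:E[EFin \o f] < c%:E)%E -> (\int[P]_x (f x ^+ 2)%:E <= (c ^+ 2)%:E)%E.
Proof.
move=> c0 Nc.
have -> : (\int[P]_x (f x ^+ 2)%:E = 'N[P]_2%:E[EFin \o f] `^ 2)%E.
  rewrite poweR_Lnorm//; apply: eq_integral => x _ /=.
  by rewrite powR_mulrn// real_normK// num_real.
have N0 := @Lnorm_ge0 _ _ _ P 2%:E (EFin \o f).
have : 'N[P]_2%:E[EFin \o f]%E \is a fin_num.
  by rewrite ge0_fin_numE// (lt_trans Nc)// ltry.
move/fineK => Ef; move: Nc N0; rewrite -Ef lte_fin lee_fin => Nc N0.
rewrite poweR_EFin lee_fin powR_mulrn// ler_sqr ?nnegrE//; exact: ltW.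
Qed.

Section brownian_bridge_paths.
Context (R : realType) dS (S : measurableType dS) (P0 : probability S R)
  (F : set (S -> R)) d (O : measurableType d) (Pr : probability O R)
  (G : O -> linf R F).
Hypothesis bb : brownian_bridge P0 Pr G.

(** The second moment of an increment is the variance of [f - g] under [P0], which
is at most the second moment of [f - g]. *)
Lemma bridge_increment_le (f g : F) :
  (\int[Pr]_o ((G o f - G o g) ^+ 2)%:E
   <= \int[P0]_y ((\val f y - \val g y) ^+ 2)%:E)%E.
Proof.
have mf := bridge_measurable bb f; have mg := bridge_measurable bb g.
have if2 := bridge_integrable_sqr bb f; have ig2 := bridge_integrable_sqr bb g.
have [L2 _ _ _ cov] := bb.
have [Mf If2] := Lfun2P (L2 f); have [Mg Ig2] := Lfun2P (L2 g).
have e1 := integrable_sqrB mf mg if2 ig2.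
have e2 := integrable_sqrB Mf Mg If2 Ig2.
rewrite -[leLHS]fineK; last exact: integrable_fin_num.
rewrite -[leRHS]fineK; last exact: integrable_fin_num.
rewrite lee_fin -/(Rintegral _ _ _) -/(Rintegral _ _ _).
rewrite !Rintegral_sqrB//.
have E (a b : F) := cov a b.
under eq_Rintegral do rewrite expr2.
have -> : \int[Pr]_o (G o g ^+ 2) = \int[Pr]_o (G o g * G o g) by [].
rewrite !cov.
have -> : \int[P0]_y (\val f y ^+ 2) = \int[P0]_y (\val f y * \val f y) by [].
have -> : \int[P0]_y (\val g y ^+ 2) = \int[P0]_y (\val g y * \val g y) by [].
have := sqr_ge0 (\int[P0]_y \val f y - \int[P0]_y \val g y); nra.
Qed.

(** Chebyshev's inequality for the increments of the bridge. *)
Lemma bridge_increment_prob (f g : F) (c e : R) (A : set O) :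
  0 < c -> 0 < e -> measurable A ->
  ('N[P0]_2%:E[EFin \o (\val f \- \val g)%R] < c%:E)%E ->
  (forall o, A o -> e <= `|G o f - G o g|) ->
  (Pr A <= (c ^+ 2 / e ^+ 2)%:E)%E.
Proof.
move=> c0 e0 mA Nc eA.
have e20 : 0 < e ^+ 2 by rewrite exprn_gt0.
rewrite mulrC EFinM lee_pdivlMl//.
apply: le_trans (Lnorm2_lt c0 Nc); apply: le_trans (bridge_increment_le f g).
have mB : measurable_fun [set: O] (fun o => ((G o f - G o g) ^+ 2)%:E).
  apply/measurable_EFinP; apply: measurable_funX; apply: measurable_funB.
  - exact: (bridge_measurable bb f).
  - exact: (bridge_measurable bb g).
apply: (@le_trans _ _ (\int[Pr]_(o in A) ((G o f - G o g) ^+ 2)%:E)%E); last first.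
  by apply: ge0_subset_integral => // o _; rewrite lee_fin sqr_ge0.
rewrite -integral_cst//; apply: ge0_le_integral => //.
- by move=> o _; rewrite lee_fin ltW.
- exact: measurable_funTS.
move=> o Ao; rewrite lee_fin -[leRHS]real_normK ?num_real//.
by rewrite ler_sqr ?nnegrE ?normr_ge0 ?(ltW e0)// eA.
Qed.

End brownian_bridge_paths.

Section brownian_bridge_equicontinuity.
Context (R : realType) dS (S : measurableType dS) (P0 : probability S R)
  (F : set (S -> R)) d (O : measurableType d) (Pr : probability O R)
  (G : O -> linf R F).
Hypothesis bb : brownian_bridge P0 Pr G.
Variable f0 : F.

(** The L2(P0)-ball around [f0] in the index set. *)
Definition near_L2 (c : R) (f : F) : Prop :=
  ('N[P0]_2%:E[EFin \o (\val f \- \val f0)%R] < c%:E)%E.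

Lemma near_L2_le c c' f : c <= c' -> near_L2 c f -> near_L2 c' f.
Proof. by move=> cc' h; apply: lt_le_trans h _; rewrite lee_fin. Qed.

Let ballo (z : linf R F) (e : R) := (ball z e)^°.

Let measurable_ballo z e : measurable (G @^-1` ballo z e).
Proof. by have [_ [mG _] _ _ _] := bb; apply: mG; exact: open_interior. Qed.

(** Either [z] itself varies by at most [3 * e] on some L2-neighbourhood of [f0],
and the triangle inequality carries this over to all paths in the ball around
[z]; or there are indices arbitrarily L2-close to [f0] at which every path in
the ball differs from its value at [f0] by more than [e], and
[bridge_increment_prob] shows that the paths in the ball form a null event. *)
Lemma bridge_local_equicontinuity (z : linf R F) (e : R) : 0 < e ->
  exists c : R, exists N : set O, [/\ 0 < c, measurable N, Pr N = 0%E &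
    forall o, ~ N o -> ballo z e (G o) ->
      forall f, near_L2 c f -> `|G o f - G o f0| <= 5 * e].
Proof.
move=> e0.
have closez o (f : F) : ballo z e (G o) -> `|z f - G o f| < e.
  move=> /interior_subset; rewrite ballEmdist/=.
  exact: le_lt_trans (linf_eval_lipschitz _ _ _).
have [[c [c0 zc]]|nc] := pselect (exists c : R, 0 < c /\
    forall f, near_L2 c f -> `|z f - z f0| <= 3 * e).
  exists c, set0; split => // o _ zo f fc.
  have := closez o f zo; have := closez o f0 zo; have := zc f fc.
  rewrite !ler_norml !ltr_norml; lra.
exists 1, (G @^-1` ballo z e); split => //.
apply/eqP; rewrite eq_le measure_ge0 andbT; apply/lee_addgt0Pr => t t0.
rewrite add0e.
have et0 : 0 < e * Num.sqrt t by rewrite mulr_gt0// sqrtr_gt0.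
(* With the radius [e * Num.sqrt t] Chebyshev's bound equals [t]. *)
have [f ff0 zf] : exists2 f, near_L2 (e * Num.sqrt t) f & 3 * e < `|z f - z f0|.
  have /forallNP/(_ (e * Num.sqrt t))/not_andP[//|/existsNP[f /not_implyP[? /negP]]] := nc.
  by rewrite -ltNge; exists f.
apply: le_trans (bridge_increment_prob bb et0 e0 _ ff0 _) _ => //.
- move=> o zo; have := closez o f zo; have := closez o f0 zo.
  rewrite !ltr_norml => h1 h2; rewrite leNgt; apply/negP; rewrite ltr_norml => h3.
  move: zf; apply/negP; rewrite -leNgt ler_norml; lra.
- rewrite lee_fin exprMn sqr_sqrtr; last exact: ltW.
  have -> // : e ^+ 2 * t / e ^+ 2 = t by field; rewrite gt_eqF.
Qed.

Lemma bridge_finite_equicontinuity (s : seq (linf R F)) (e : R) : 0 < e ->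
  exists c : R, exists N : set O, [/\ 0 < c, measurable N, Pr N = 0%E &
    forall o, ~ N o -> forall z, z \in s -> ballo z e (G o) ->
      forall f, near_L2 c f -> `|G o f - G o f0| <= 5 * e].
Proof.
move=> e0; elim: s => [|z s [c [N [c0 mN N0 cN]]]].
  by exists 1, set0; split.
have [c' [N' [c'0 mN' N'0 cN']]] := bridge_local_equicontinuity z e0.
exists (Num.min c c'), (N `|` N'); split.
- by rewrite lt_min c0.
- exact: measurableU.
- apply/eqP; rewrite eq_le measure_ge0 andbT.
  by apply: le_trans (measureU2 _ _ _) _ => //; rewrite [X in (X + _)%E]N0 [X in (_ + X)%E]N'0 adde0.
- move=> o /not_orP[No N'o] z'; rewrite inE => /predU1P[->|z's] zo f fc.
  + by apply: cN' => //; apply: near_L2_le fc; rewrite ge_min lexx orbT.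
  + by apply: (cN _ _ z') => //; apply: near_L2_le fc; rewrite ge_min lexx.
Qed.

(** The exceptional event is the escape from a compact set given by tightness,
together with the finitely many null events of a finite cover by balls. *)
Lemma bridge_equicontinuity (e t : R) : 0 < e -> 0 < t ->
  exists c : R, exists B : set O, [/\ 0 < c, measurable B, (Pr B <= t%:E)%E &
    forall o, ~ B o -> forall f, near_L2 c f -> `|G o f - G o f0| <= 5 * e].
Proof.
move=> e0 t0.
have [_ [mG tG] _ _ _] := bb; have [K cK PK] := tG t t0.
have mK : measurable (G @^-1` K).
  rewrite -[K]setCK preimage_setC; apply: measurableC.
  apply: (mG (~` K)); rewrite openC.
  by apply: compact_closed => //; exact: metric_hausdorff.
have [|z _|D' _ KD'] := compact_finite_cover cK (D := setT) (f := fun z => ballo z e).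
- by move=> z _; exact: open_interior.
- by exists z => //; exact: nbhsx_ballx.
have [c [N [c0 mN N0 cN]]] := bridge_finite_equicontinuity D' e0.
exists c, (~` (G @^-1` K) `|` N); split => //.
- by apply: measurableU => //; exact: measurableC.
- apply: le_trans (measureU2 _ _ _) _ => //; first exact: measurableC.
  rewrite [X in (_ + X)%E]N0 adde0.
  apply: (@le_trans _ _ (1 - Pr (G @^-1` K))%E).
    by rewrite -probability_setC.
  by rewrite leeBlDr ?fin_num_measure// addeC -leeBlDr// -EFinB.
move=> o /not_orP[/contrapT Ko No] f fc.
have [z zD' zo] := KD' _ Ko.
exact: (cN o No z).
Qed.

End brownian_bridge_equicontinuity.

(** The modulus of continuity at [f0] over an L2-neighbourhood is Lipschitz in the
path, with constant 2.  Halving and truncating it gives a function in [BL1] to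
which both modes of weak convergence apply. *)
Section modulus.
Context (R : realType) dS (S : measurableType dS) (P0 : probability S R)
  (F : set (S -> R)) (f0 : F) (c : R).
Hypothesis c0 : 0 < c.

Let increment (z : linf R F) : set R :=
  [set `|z f - z f0| | f in near_L2 P0 f0 c].

Definition modulus (z : linf R F) : R := sup (increment z).

Lemma near_L2_refl : near_L2 P0 f0 c f0.
Proof.
rewrite /near_L2 (_ : EFin \o _ = cst 0%E); first by rewrite Lnorm0 ?lte_fin.
by apply/funext => y /=; rewrite subrr.
Qed.

Lemma increment_le_modulus (z : linf R F) (f : F) :
  near_L2 P0 f0 c f -> `|z f - z f0| <= modulus z.
Proof.
move=> fc; apply: ub_le_sup; last by exists f.
have [a za] := linf_bounded z; exists (a + a) => _ [g _ <-].
by apply: (le_trans (ler_normB _ _)); apply: lerD; apply: za; [exists g|exists f0].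
Qed.

Lemma modulus_le (z : linf R F) (a : R) :
  (forall f, near_L2 P0 f0 c f -> `|z f - z f0| <= a) -> modulus z <= a.
Proof.
move=> za; apply: ge_sup; last by move=> _ [f fc <-]; exact: za.
by exists `|z f0 - z f0|; exists f0 => //; exact: near_L2_refl.
Qed.

Lemma modulus_lipschitz (z z' : linf R F) :
  modulus z <= modulus z' + 2 * mdist z z'.
Proof.
apply: modulus_le => f fc.
have := increment_le_modulus z' fc.
have := linf_eval_lipschitz f z z'; have := linf_eval_lipschitz f0 z z'.
rewrite !ler_norml; lra.
Qed.

(** The threshold [5 * e] is the oscillation allowed by [bridge_equicontinuity];
the test function reaches the level [e] once the oscillation is [7 * e]. *)
Definition modulus_test (e : R) (z : linf R F) : R :=
  Num.min 1 (Num.max 0 ((modulus z - 5 * e) / 2)).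

Lemma modulus_test_BL1 e : BL1 (modulus_test e).
Proof.
split=> [z|z z'].
  rewrite /modulus_test ger0_norm; first by rewrite ge_min lexx.
  by rewrite le_min ler01 le_max lexx.
have := modulus_lipschitz z z'; have := modulus_lipschitz z' z.
rewrite metric_sym /modulus_test.
have := mdist_ge0 z z'; set m := mdist z z'.
move=> m0 h1 h2.
rewrite ler_norml.
case: (leP 0 ((modulus z - 5 * e) / 2)) => ?;
case: (leP 0 ((modulus z' - 5 * e) / 2)) => ?;
rewrite ?minEle; repeat (case: ifPn); rewrite -?ltNge; lra.
Qed.

Lemma modulus_test_ge0 e z : 0 <= modulus_test e z.
Proof. by rewrite /modulus_test le_min ler01 le_max lexx. Qed.

Lemma modulus_test_ge e (z : linf R F) (f : F) : e <= 1 -> near_L2 P0 f0 c f ->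
  7 * e <= `|z f - z f0| -> e <= modulus_test e z.
Proof.
move=> e1 fc ez; rewrite /modulus_test le_min e1 le_max; apply/orP; right.
by have := increment_le_modulus z fc; lra.
Qed.

End modulus.

(** Off an event of probability at most [t] the modulus is below the threshold, so
that the test function vanishes there. *)
Lemma bridge_modulus_test (R : realType) dS (S : measurableType dS)
  (P0 : probability S R) (F : set (S -> R)) d (O : measurableType d)
  (Pr : probability O R) (G : O -> linf R F) (f0 : F) (e t : R) :
  brownian_bridge P0 Pr G -> 0 < e -> 0 < t ->
  exists2 c : R, 0 < c &
    (\int[Pr]_o (modulus_test P0 f0 c e (G o))%:E <= t%:E)%E.
Proof.
move=> bb e0 t0.
have [c [B [c0 mB PB cB]]] := bridge_equicontinuity bb f0 e0 t0.
exists c => //; apply: le_trans PB; rewrite -(setIT B) -integral_indic//.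
have [_ [mG _] _ _ _] := bb.
apply: ge0_le_integral => //.
- by move=> o _; rewrite lee_fin modulus_test_ge0.
- apply/measurable_EFinP; apply: (borel_measurable_comp mG).
  by apply: lipschitz1_continuous; case: (modulus_test_BL1 P0 f0 c0 e).
- by apply/measurable_EFinP; exact: measurable_indic.
move=> o _; rewrite lee_fin indicE.
case: (boolP (o \in B)) => [_|/negP oB]; first by rewrite /modulus_test ge_min lexx.
rewrite /modulus_test ge_min; apply/orP; right; rewrite ge_max lexx/=.
rewrite pmulr_lle0// subr_le0; apply: modulus_le => // f fc.
by apply: cB => // Bo; apply: oB; exact: mem_set.
Qed.

(** * Outer probability and events of high probability *)

Section outer.
Context (R : realType) d (T : measurableType d) (mu : probability T R).
Local Open Scope ereal_scope.

Lemma outer_expectation_le_integral (h U : T -> \bar R) :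
  measurable_fun [set: T] U -> (forall w, 0 <= U w) -> (forall w, h w <= U w) ->
  outer_expectation mu h <= \int[mu]_w U w.
Proof.
move=> mU U0 hU; apply: ereal_inf_lbound; exists U => //; split => //; right.
by under eq_integral => w _ do rewrite (@ge0_funenegE _ _ setT) ?inE//=; rewrite integral0 ltry.
Qed.

(** A measurable majorant [U] of the indicator of [A] gives the measurable cover
[1 <= U] of [A], and conversely a countable measurable cover gives the indicator
of its union as a majorant. *)
Lemma outer_probE (A : set T) : outer_prob mu A = (mu^*)%mu A.
Proof.
apply/eqP; rewrite eq_le; apply/andP; split.
- apply: le_ereal_inf_tmp => _ [B [mB AB] <-].
  have mUB : measurable (\bigcup_k B k) by exact: bigcup_measurable.
  apply: le_trans (measure_sigma_subadditive mu mB mUB (@subset_refl _ _)).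
  rewrite -(setIT (\bigcup_k B k)) -integral_indic//.
  apply: outer_expectation_le_integral.
  + by apply/measurable_EFinP; exact: measurable_indic.
  + by move=> w; rewrite lee_fin indicE ler0n.
  + move=> w; rewrite lee_fin !indicE.
    case: (boolP (w \in A)) => [/set_mem/AB/mem_set -> //|_]; exact: ler0n.
- apply: le_ereal_inf_tmp => _ [U [mU _ AU] <-].
  have U0 w : 0 <= U w by apply: le_trans (AU w); rewrite lee_fin indicE ler0n.
  pose B := [set w | 1 <= U w].
  have mB : measurable B.
    by rewrite /B -[X in measurable X]setTI; exact: emeasurable_fun_c_infty.
  apply: (@le_trans _ _ (mu B)).
    rewrite -(measurable_mu_extE mu mB); apply: le_mu_ext => w Aw.
    by have := AU w; rewrite indicE mem_set.
  rewrite -(setIT B) -integral_indic//; apply: ge0_le_integral => //.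
  + by apply/measurable_EFinP; exact: measurable_indic.
  + move=> w _; rewrite indicE; case: (boolP (w \in B)) => [/set_mem|_] //=.
Qed.

Lemma outer_prob_ge0 A : 0 <= outer_prob mu A.
Proof. by rewrite outer_probE; exact: outer_measure_ge0. Qed.

Lemma outer_prob_le A B : A `<=` B -> outer_prob mu A <= outer_prob mu B.
Proof. by move=> AB; rewrite !outer_probE; exact: le_outer_measure. Qed.

Lemma outer_probU A B : outer_prob mu (A `|` B) <= outer_prob mu A + outer_prob mu B.
Proof. by rewrite !outer_probE; exact: outer_measureU2. Qed.

Lemma outer_prob_fin_num A : outer_prob mu A \is a fin_num.
Proof.
rewrite ge0_fin_numE ?outer_prob_ge0//.
apply: le_lt_trans (outer_prob_le (@subsetT _ A)) _.
by rewrite outer_probE measurable_mu_extE//= probability_setT ltry.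
Qed.

(** Markov's inequality: dividing a measurable majorant of [h] by [k] gives one
of the indicator of [A]. *)
Lemma outer_prob_markov (h : T -> R) (A : set T) (k : R) : (0 < k)%R ->
  (forall w, (0 <= h w)%R) -> (forall w, A w -> (k <= h w)%R) ->
  k%:E * outer_prob mu A <= outer_expectation mu (EFin \o h).
Proof.
move=> k0 h0 Ah; apply: le_ereal_inf_tmp => _ [U [mU _ hU] <-].
have U0 w : 0 <= U w by apply: le_trans (hU w); rewrite lee_fin.
rewrite muleC -lee_pdivlMr// muleC -ge0_integralZl//; last first.
  by rewrite lee_fin invr_ge0 ltW.
apply: outer_expectation_le_integral.
- exact: measurable_funeM.
- by move=> w; rewrite mule_ge0// lee_fin invr_ge0 ltW.
move=> w; rewrite lee_pdivlMl// indicE.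
case: (boolP (w \in A)) => [/set_mem Aw|_]; last by rewrite mule0.
by rewrite mule1; apply: le_trans (hU w); rewrite lee_fin Ah.
Qed.

(** The converse bound, for functions below [k] that are nonpositive off [A]. *)
Lemma outer_expectation_le_prob (h : T -> R) (A : set T) (k : R) : (0 < k)%R ->
  (forall w, (h w <= k)%R) -> (forall w, ~ A w -> (h w <= 0)%R) ->
  outer_expectation mu (EFin \o h) <= k%:E * outer_prob mu A.
Proof.
move=> k0 hk Ah; rewrite -lee_pdivrMl//.
apply: le_ereal_inf_tmp => _ [U [mU _ AU] <-].
have U0 w : 0 <= U w by apply: le_trans (AU w); rewrite lee_fin indicE ler0n.
rewrite lee_pdivrMl// -ge0_integralZl//; last by rewrite lee_fin ltW.
apply: outer_expectation_le_integral.
- exact: measurable_funeM.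
- by move=> w; rewrite mule_ge0// lee_fin ltW.
move=> w; case: (pselect (A w)) => Aw.
- have := AU w; rewrite indicE mem_set// => /(lee_wpmul2l (ltW k0 : (0 <= k%:E)%E)).
  by rewrite mule1; apply: le_trans; rewrite lee_fin.
- by apply: le_trans (_ : 0 <= _); rewrite ?mule_ge0 ?lee_fin ?Ah// ltW.
Qed.

End outer.

Lemma cvg_EFin_near (R : realType) (u : nat -> \bar R) (l : R) :
  (forall n, u n \is a fin_num) ->
  u @ \oo --> l%:E <->
  (forall e : R, 0 < e ->
    \forall n \near \oo, ((l - e)%R%:E <= u n <= (l + e)%R%:E)%E).
Proof.
move=> uf.
have E n e : ((l - e)%R%:E <= u n <= (l + e)%R%:E)%E = (`|l - fine (u n)| <= e).
  by rewrite -(fineK (uf n)) !lee_fin ler_norml /=; apply/idP/idP; lra.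
split=> [/fine_cvgP[_ /cvgrPdist_le h] e e0|h].
  by have := h e e0; apply: filterS => n; rewrite E.
apply/fine_cvgP; split; first exact: nearW.
by apply/cvgrPdist_le => e e0; have := h e e0; apply: filterS => n; rewrite E.
Qed.

Lemma cvge_lt_near (R : realType) (u : nat -> \bar R) (l b : \bar R) :
  u @ \oo --> l -> (l < b)%E -> \forall n \near \oo, (u n < b)%E.
Proof. by move=> ul lb; exact: (ul _ (open_ereal_lt' lb)). Qed.

Lemma cvge_gt_near (R : realType) (u : nat -> \bar R) (l b : \bar R) :
  u @ \oo --> l -> (b < l)%E -> \forall n \near \oo, (b < u n)%E.
Proof. by move=> ul lb; exact: (ul _ (open_ereal_gt' lb)). Qed.

Section with_high_probability.
Context (R : realType) dS (S : measurableType dS) (P0 : probability S R).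
Local Open Scope ereal_scope.
Implicit Types A B : forall n, set (n.-tuple S).

Lemma outer_P0_ge0 n (A : set (n.-tuple S)) : 0 <= outer_P0 P0 A.
Proof. exact: outer_measure_ge0. Qed.

Lemma outer_P0_fin_num n (A : set (n.-tuple S)) : outer_P0 P0 A \is a fin_num.
Proof. by rewrite /outer_P0 -outer_probE outer_prob_fin_num. Qed.

Lemma outer_P0_le n (A B : set (n.-tuple S)) : A `<=` B -> outer_P0 P0 A <= outer_P0 P0 B.
Proof. exact: le_outer_measure. Qed.

Lemma outer_P0U n (A B : set (n.-tuple S)) :
  outer_P0 P0 (A `|` B) <= outer_P0 P0 A + outer_P0 P0 B.
Proof. exact: outer_measureU2. Qed.

(** With inner probability tending to one.  Conditions on outer probabilities
combine only through the complements, for lack of additivity. *)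
Definition whp A : Prop := outer_P0 P0 (~` A n) @[n --> \oo] --> 0%E.

Lemma whpP A : whp A <->
  forall e : R, (0 < e)%R -> \forall n \near \oo, outer_P0 P0 (~` A n) <= e%:E.
Proof.
rewrite /whp cvg_EFin_near; last by move=> n; exact: outer_P0_fin_num.
split=> h e e0; have := h e e0; apply: filterS => n.
  by rewrite !add0r => /andP[].
rewrite !add0r => ->; rewrite andbT.
by apply: le_trans (outer_P0_ge0 _); rewrite lee_fin oppr_le0 ltW.
Qed.

Lemma whpI A B : whp A -> whp B -> whp (fun n => A n `&` B n).
Proof.
move=> /whpP hA /whpP hB; apply/whpP => e e0.
have e2 : (0 < e / 2)%R by rewrite divr_gt0.
have := hB _ e2; have := hA _ e2; apply: filterS2 => n hAn hBn.
rewrite setCI; apply: le_trans (outer_P0U _ _) _.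
by apply: le_trans (leeD hAn hBn) _; rewrite -EFinD -splitr.
Qed.

Lemma whpS A B : whp A -> (\forall n \near \oo, A n `<=` B n) -> whp B.
Proof.
move=> /whpP hA AB; apply/whpP => e e0; have := hA _ e0.
apply: filterS2 AB => n ABn; apply: le_trans.
by apply: outer_P0_le; exact: subsetC.
Qed.

Lemma cvg0_outer_whp (Y : forall n, n.-tuple S -> \bar R) (e : R) :
  cvg0_outer P0 Y -> (0 < e)%R -> whp (fun n => [set x | `|Y n x| < e%:E]).
Proof.
move=> hY e0; rewrite /whp.
rewrite (_ : (fun n => _) = (fun n => outer_P0 P0 [set x | e%:E <= `|Y n x|])).
  exact: hY.
apply/funext => n; congr (outer_P0 _ _); apply/seteqP.
by split => x /=; rewrite leNgt => /negP.
Qed.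

End with_high_probability.

(** * Linearization at a random index *)

Section donsker.
Context (R : realType) dS (S : measurableType dS) (P0 : probability S R).
Let sd0 n (x : n.-tuple S) (f : S -> R) : R := scaled_diff n (empirical R x) P0 f.

(** Replacing the random index [phin n x] by [phi0] costs [o(1)]: on the event
that [phin n x] lies in the class and is L2-close to [phi0], an increment of
size [e] raises the test function of the modulus of continuity, whose limiting
expectation is as small as desired.  The second part is the convergence of the
marginal at [phi0], which is the composition with an evaluation map. *)
Lemma donsker_linearization (phi0 : S -> R) (phin : forall n, n.-tuple S -> S -> R) :
  donsker_cond P0 phi0 phin ->
  oP0 P0 (fun n x => 'N[P0]_2%:E[EFin \o (phin n x \- phi0)%R])%E (fun=> 1) ->
  (forall e, 0 < e ->
     whp P0 (fun n => [set x | `|sd0 x (phin n x) - sd0 x phi0| < e])) /\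
  exists d (O : measurableType d) (Pr : probability O R) (Z : O -> R) (s : R),
  [/\ measurable_fun [set: O] Z,
     forall A : set R, measurable A -> Pr [set o | A (Z o)] = normal_law 0 s A,
     s ^+ 2 * std_normal_sqr =
       \int[P0]_y (phi0 y ^+ 2) - (\int[P0]_y phi0 y) ^+ 2
   & forall h : R -> R, (forall y y', `|h y - h y'| <= `|y - y'|) ->
       (forall y, `|h y| <= 1) ->
       outer_expectation (iid_law P0 n) (fun x => (h (sd0 x phi0))%:E) @[n --> \oo]
         --> (\int[Pr]_o (h (Z o))%:E)%E].
Proof.
move=> [F [mF F0 Fn [Gn [dO [Om [Pr [G [GnE bb wc]]]]]]]] hN.
pose f0 : F := exist _ phi0 (mem_set F0).
split; last first.
  have [s [law var]] := bridge_marginal_centered bb f0.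
  exists dO, Om, Pr, (fun o => G o f0), s; split => //.
    exact: (bridge_measurable bb f0).
  move=> h hL h1.
  rewrite (_ : (fun n => _) = (fun n => outer_expectation (iid_law P0 n)
      (fun x => (h (Gn n x f0))%:E))); last first.
    by apply/funext => n; congr outer_expectation; apply/funext => x; rewrite GnE.
  apply: (wc (fun z => h (z f0))); last by exists 1 => z; exact: h1.
  apply: lipschitz1_continuous => z z'; apply: le_trans (hL _ _) _.
  exact: linf_eval_lipschitz.
move=> e e0.
pose e' := Num.min 1 (e / 7).
have e'0 : 0 < e' by rewrite lt_min ltr01 divr_gt0.
have e'1 : e' <= 1 by rewrite ge_min lexx.
have e'e : 7 * e' <= e by rewrite mulrC -ler_pdivlMr// ge_min lexx orbT.
apply/whpP => t t0.
have t4 : 0 < t / 4 by rewrite divr_gt0.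
have et4 : 0 < e' * (t / 4) by rewrite mulr_gt0.
have [c c0 Ec] := bridge_modulus_test f0 bb e'0 et4.
pose h := modulus_test P0 f0 c e'.
have [h1 hL] := modulus_test_BL1 P0 f0 c0 e'.
have h0 : forall z, 0 <= h z by move=> z; exact: modulus_test_ge0.
have hc := wc h (lipschitz1_continuous hL) (ex_intro _ 1 h1).
have ih : (\int[Pr]_o (h (G o))%:E)%E \is a fin_num.
  rewrite ge0_fin_numE; first by apply: le_lt_trans Ec _; exact: ltry.
  by apply: integral_ge0 => o _; rewrite lee_fin.
have near1 : \forall n \near \oo, (outer_expectation (iid_law P0 n)
    (fun x => (h (Gn n x))%:E) <= (e' * (t / 4) + e' * (t / 4))%:E)%E.
  have lt1 : (\int[Pr]_o (h (G o))%:E < (e' * (t / 4) + e' * (t / 4))%:E)%E.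
    by apply: le_lt_trans Ec _; rewrite lte_fin ltrDl.
  by apply: filterS (cvge_lt_near hc lt1) => n /ltW.
have near2 : \forall n \near \oo,
    (outer_P0 P0 [set x | ~ F (phin n x)] <= (t / 4)%:E)%E.
  have : whp P0 (fun n => [set x | F (phin n x)]) by exact: Fn.
  by move=> /whpP/(_ _ t4).
have near3 : \forall n \near \oo, (outer_P0 P0 (~` [set x : n.-tuple S |
    'N[P0]_2%:E[EFin \o (phin n x \- phi0)%R] < c%:E]) <= (t / 4)%:E)%E.
  have w : whp P0 (fun n => [set x |
      ('N[P0]_2%:E[EFin \o (phin n x \- phi0)%R] < c%:E)%E]).
    apply: whpS (cvg0_outer_whp hN c0) _; apply: nearW => n x /=.
    by rewrite invr1 mule1 gee0_abs// Lnorm_ge0.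
  by move/whpP: w => /(_ _ t4).
apply: filterS3 near1 near2 near3 => n N1 N2 N3.
pose B1 := [set x : n.-tuple S | ~ F (phin n x)].
pose B2 := ~` [set x : n.-tuple S | ('N[P0]_2%:E[EFin \o (phin n x \- phi0)%R] < c%:E)%E].
pose B3 := [set x : n.-tuple S | e' <= h (Gn n x)].
have B3t : (outer_P0 P0 B3 <= (t / 4 + t / 4)%:E)%E.
  rewrite -(lee_pmul2l (x := e'%:E))// /outer_P0 -outer_probE.
  apply: (le_trans (outer_prob_markov _ e'0 (fun x => h0 (Gn n x)) (fun x => id))).
  by rewrite -EFinM mulrDr.
apply: (@le_trans _ _ (outer_P0 P0 (B1 `|` (B2 `|` B3)))).
  apply: outer_P0_le => x /= /negP; rewrite -leNgt => ex.
  have [Fx|] := pselect (F (phin n x)); last by left.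
  right; have [Nx|] := pselect (('N[P0]_2%:E[EFin \o (phin n x \- phi0)%R] < c%:E)%E); last by left.
  right; pose f : F := exist _ (phin n x) (mem_set Fx).
  apply: (modulus_test_ge (f := f)) => //.
  by rewrite !GnE; exact: le_trans ex.
apply: le_trans (outer_P0U _ _ _) _.
have -> : t = t / 4 + (t / 4 + (t / 4 + t / 4)) by field.
rewrite [X in (_ <= X)%E]EFinD; apply: leeD; first exact: N2.
rewrite EFinD; apply: le_trans (outer_P0U _ _ _) _.
by apply: leeD.
Qed.

End donsker.

Lemma abse_subr_lt (R : realType) (x : \bar R) (b r : R) :
  (`|x - b%:E| < r%:E)%E -> ((b - r)%R%:E <= x <= (b + r)%R%:E)%E.
Proof.
case: x => [x||]//; rewrite -EFinB abse_EFin lte_fin !lee_fin ltr_norml; lra.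
Qed.

Section bootstrap_donsker.
Context (R : realType) dS (S : measurableType dS) (P0 : probability S R).
Context (dW : nat -> measure_display) (W : forall n, measurableType (dW n)).
Variable Q : forall n, probability (W n) R.
Variable g : forall n, {mfun (n.-tuple S * W n)%type >-> S}.

Let sds n (x : n.-tuple S) (w : n.-tuple (W n)) (f : S -> R) : R :=
  scaled_diff n (empirical R (bootstrap_sample (g n) x w))
    (resample_law (g n) (Q n) x) f.

(** The supremum over [BL1] dominates each of its terms, so one event of high
probability serves all test functions at once. *)
Lemma cond_weak_cvg_whp (D : metricType R)
    (Gn : forall n, n.-tuple S -> n.-tuple (W n) -> D)
    d (O : measurableType d) (Pr : probability O R) (G : O -> D) (r : R) :
  cond_weak_cvg P0 Q Gn Pr G -> 0 < r ->
  whp P0 (fun n => [set x | forall h : D -> R, BL1 h ->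
    (`| outer_EW Q (fun x w => (h (Gn n x w))%:E) x
        - \int[Pr]_o (h (G o))%:E | < r%:E)%E]).
Proof.
move=> wc r0; apply: whpS (cvg0_outer_whp wc r0) _.
apply: nearW => n x /= hr h hB; apply: le_lt_trans hr.
by apply: le_trans (lee_abs _); apply: ereal_sup_ubound; exists h.
Qed.

(** The argument of [donsker_linearization], carried out for fixed data: on one
event of high probability the conditional expectation of the test function is
close to its expectation under the bridge.  In the second part the test function
[h] is quantified after the data; uniformity in [h] is what makes the bootstrap
distribution function uniformly close to its limit. *)
Lemma bootstrap_linearization (phi0 : S -> R)
    (phis : forall n, n.-tuple S -> n.-tuple (W n) -> S -> R) :
  boot_donsker_cond P0 Q g phi0 phis ->
  oPW P0 Q (fun n x w => 'N[P0]_2%:E[EFin \o (phis n x w \- phi0)%R])%E (fun=> 1) ->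
  (forall e t, 0 < e -> 0 < t ->
     whp P0 (fun n => [set x | (outer_PW Q (fun x => [set w |
       (e <= `|sds x w (phis n x w) - sds x w phi0|)%R]) x < t%:E)%E])) /\
  exists d (O : measurableType d) (Pr : probability O R) (Z : O -> R) (s : R),
  [/\ measurable_fun [set: O] Z,
     forall A : set R, measurable A -> Pr [set o | A (Z o)] = normal_law 0 s A,
     s ^+ 2 * std_normal_sqr =
       \int[P0]_y (phi0 y ^+ 2) - (\int[P0]_y phi0 y) ^+ 2
   & forall r, 0 < r -> whp P0 (fun n => [set x | forall h : R -> R,
       (forall y y', `|h y - h y'| <= `|y - y'|) -> (forall y, `|h y| <= 1) ->
       (`| outer_EW Q (fun x w => (h (sds x w phi0))%:E) x
           - \int[Pr]_o (h (Z o))%:E | < r%:E)%E])].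
Proof.
move=> [F [mF F0 Fn [Gn [dO [Om [Pr [G [_ GnE bb wc]]]]]]]] hN.
pose f0 : F := exist _ phi0 (mem_set F0).
split; last first.
  have [s [law var]] := bridge_marginal_centered bb f0.
  exists dO, Om, Pr, (fun o => G o f0), s; split => //.
    exact: (bridge_measurable bb f0).
  move=> r r0; apply: whpS (cond_weak_cvg_whp wc r0) _.
  apply: nearW => n x /= hr h hL h1.
  have := hr (fun z => h (z f0)).
  rewrite (_ : outer_EW _ _ _ = outer_EW Q (fun x w => (h (sds x w phi0))%:E) x); last first.
    by congr outer_expectation; apply/funext => w; rewrite GnE.
  apply; split=> [z|z z']; first exact: h1.
  by apply: le_trans (hL _ _) _; exact: linf_eval_lipschitz.
move=> e t e0 t0.
pose e' := Num.min 1 (e / 7).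
have e'0 : 0 < e' by rewrite lt_min ltr01 divr_gt0.
have e'1 : e' <= 1 by rewrite ge_min lexx.
have e'e : 7 * e' <= e by rewrite mulrC -ler_pdivlMr// ge_min lexx orbT.
have t4 : 0 < t / 4 by rewrite divr_gt0.
have et4 : 0 < e' * (t / 4) by rewrite mulr_gt0.
have [c c0 Ec] := bridge_modulus_test f0 bb e'0 et4.
pose h := modulus_test P0 f0 c e'.
have hB : BL1 h := modulus_test_BL1 P0 f0 c0 e'.
have h0 : forall z, 0 <= h z by move=> z; exact: modulus_test_ge0.
have ih : (\int[Pr]_o (h (G o))%:E)%E \is a fin_num.
  rewrite ge0_fin_numE; first by apply: le_lt_trans Ec _; exact: ltry.
  by apply: integral_ge0 => o _; rewrite lee_fin.
have w1 := cond_weak_cvg_whp wc et4.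
have w2 := cvg0_outer_whp Fn t4.
have w3 := cvg0_outer_whp (hN c c0) t4.
apply: whpS (whpI w1 (whpI w2 w3)) _; apply: nearW => n x /= [/(_ h hB) hx [Fx Nx]].
have pos (A : n.-tuple S -> set (n.-tuple (W n))) : (0 <= outer_PW Q A x)%E.
  exact: outer_prob_ge0.
rewrite gee0_abs// in Fx; rewrite gee0_abs// in Nx.
pose B1 := [set w : n.-tuple (W n) | ~ F (phis n x w)].
pose B2 := [set w : n.-tuple (W n) |
  (c%:E <= `|'N[P0]_2%:E[EFin \o (phis n x w \- phi0)%R] * (1^-1)%:E|)%E].
pose B3 := [set w : n.-tuple (W n) | e' <= h (Gn n x w)].
pose mu := iid_law (Q n) n.
have B3t : (outer_prob mu B3 <= (t / 4 + t / 4)%:E)%E.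
  rewrite -(lee_pmul2l (x := e'%:E))//.
  apply: (le_trans (outer_prob_markov _ e'0 (fun w => h0 (Gn n x w)) (fun w => id))).
  rewrite -EFinM mulrDr EFinD.
  move: hx Ec; rewrite -(fineK ih) lee_fin => /abse_subr_lt/andP[_ hx] Ec.
  apply: le_trans hx _; rewrite -EFinD lee_fin; lra.
apply: (@le_lt_trans _ _ (outer_prob mu (B1 `|` (B2 `|` B3)))).
  apply: outer_prob_le => w /= ex.
  have [Fxw|] := pselect (F (phis n x w)); last by left.
  right; have [Nxw|/negP] := pselect (('N[P0]_2%:E[EFin \o (phis n x w \- phi0)%R] < c%:E)%E); last first.
    by rewrite -leNgt => Nxw; left; rewrite /B2/= invr1 mule1 gee0_abs// Lnorm_ge0.
  right; pose f : F := exist _ (phis n x w) (mem_set Fxw).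
  apply: (modulus_test_ge (f := f)) => //.
  by rewrite !GnE; exact: le_trans ex.
apply: le_lt_trans (outer_probU _ _ _) _.
have -> : t = t / 4 + (t / 4 + (t / 4 + t / 4)) by field.
rewrite [X in (_ < X)%E]EFinD; apply: lte_leD => //; first exact: outer_prob_fin_num.
rewrite EFinD; apply: le_trans (outer_probU _ _ _) _.
by apply: leeD => //; exact: ltW.
Qed.

End bootstrap_donsker.

(** * From test functions to distribution functions *)

Section integral_bounds.
Context (R : realType) d (O : measurableType d) (P : probability O R).
Variables (h : O -> R) (A : set O) (k : R).
Hypotheses (mh : measurable_fun [set: O] h) (mA : measurable A) (k0 : 0 <= k).
Hypothesis h0 : forall o, 0 <= h o.

Lemma integral_le_prob : (forall o, h o <= k) -> (forall o, ~ A o -> h o <= 0) ->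
  (\int[P]_o (h o)%:E <= k%:E * P A)%E.
Proof.
move=> hk hA; rewrite -(setIT A) -integral_indic// -ge0_integralZl; last 4 first.
- exact: measurableT.
- by apply/measurable_EFinP; exact: measurable_indic.
- by move=> o _; rewrite lee_fin indicE ler0n.
- by rewrite lee_fin.
apply: ge0_le_integral => //.
- by move=> o _; rewrite lee_fin.
- exact/measurable_EFinP.
- apply: measurable_funeM; apply/measurable_EFinP; exact: measurable_indic.
move=> o _; rewrite -EFinM lee_fin indicE.
by case: (boolP (o \in A)) => [_|/negP oA]; rewrite ?mulr1 ?mulr0 ?hk// hA// => /mem_set.
Qed.

Lemma prob_le_integral : (forall o, A o -> k <= h o) ->
  (k%:E * P A <= \int[P]_o (h o)%:E)%E.
Proof.
move=> hA; rewrite -(setIT A) -integral_indic// -ge0_integralZl; last 4 first.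
- exact: measurableT.
- by apply/measurable_EFinP; exact: measurable_indic.
- by move=> o _; rewrite lee_fin indicE ler0n.
- by rewrite lee_fin.
apply: ge0_le_integral => //.
- by move=> o _; rewrite -EFinM lee_fin mulr_ge0// indicE ler0n.
- apply: measurable_funeM; apply/measurable_EFinP; exact: measurable_indic.
- exact/measurable_EFinP.
move=> o _; rewrite -EFinM lee_fin indicE.
by case: (boolP (o \in A)) => [/set_mem oA|_]; rewrite ?mulr1 ?mulr0 ?hA.
Qed.

End integral_bounds.

(** Truncated distances of height [k] with slope at most 1: as [k <= 1] in all
uses they belong to [BL1] without rescaling, at the price of a factor [k] in
every integral. *)
Section test_functions.
Context {R : realType}.
Implicit Types a b k y : R.

Definition lower_ramp a k y := Num.max 0 (Num.min k (a - y + k)).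
Definition trapezoid a b k y :=
  Num.max 0 (Num.min k (Num.min (y - a + k) (b - y + k))).

Lemma lower_ramp_ge0 a k y : 0 <= lower_ramp a k y.
Proof. by rewrite le_max lexx. Qed.

Lemma lower_ramp_le a k y : 0 <= k -> lower_ramp a k y <= k.
Proof. by move=> k0; rewrite ge_max k0 ge_min lexx. Qed.

Lemma lower_ramp_ge a k y : y <= a -> k <= lower_ramp a k y.
Proof. by move=> ya; rewrite le_max le_min lexx/=; apply/orP; right; lra. Qed.

Lemma lower_ramp_le0 a k y : a + k < y -> lower_ramp a k y <= 0.
Proof. by move=> ay; rewrite ge_max lexx ge_min/=; apply/orP; right; lra. Qed.

Lemma lower_ramp_lipschitz a k y y' :
  `|lower_ramp a k y - lower_ramp a k y'| <= `|y - y'|.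
Proof.
have := ler_norm (y - y'); have := ler_norm (- (y - y')); rewrite normrN.
set m := `|_|; move=> h1 h2; rewrite ler_norml /lower_ramp.
by rewrite !maxEle !minEle; repeat (case: ifPn); rewrite -?ltNge; lra.
Qed.

Lemma trapezoid_ge0 a b k y : 0 <= trapezoid a b k y.
Proof. by rewrite le_max lexx. Qed.

Lemma trapezoid_le a b k y : 0 <= k -> trapezoid a b k y <= k.
Proof. by move=> k0; rewrite ge_max k0 ge_min lexx. Qed.

Lemma trapezoid_ge a b k y : a <= y <= b -> k <= trapezoid a b k y.
Proof.
by move=> /andP[ay yb]; rewrite le_max !le_min lexx/=; apply/orP; right; lra.
Qed.

Lemma trapezoid_le0 a b k y : ~~ (a - k <= y <= b + k) -> trapezoid a b k y <= 0.
Proof.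
rewrite negb_and -!ltNge => /orP[] h; rewrite ge_max lexx !ge_min/=;
  apply/orP; right; apply/orP; [left|right]; lra.
Qed.

Lemma trapezoid_lipschitz a b k y y' :
  `|trapezoid a b k y - trapezoid a b k y'| <= `|y - y'|.
Proof.
have := ler_norm (y - y'); have := ler_norm (- (y - y')); rewrite normrN.
set m := `|_|; move=> h1 h2; rewrite ler_norml /trapezoid.
by rewrite !maxEle !minEle; repeat (case: ifPn); rewrite -?ltNge; lra.
Qed.

End test_functions.

(** Half-lines and intervals are squeezed between test functions whose supports
differ by a few multiples of [k]; for the limit law this costs little as the
distribution function [F] is Lipschitz. *)
Section normal_sandwich.
Context (R : realType) d (O : measurableType d) (Pr : probability O R).
Variables (Z : O -> R) (s : R).
Hypotheses (mZ : measurable_fun [set: O] Z) (s0 : s != 0).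
Hypothesis ZE : forall A : set R, measurable A ->
  Pr [set o | A (Z o)] = normal_prob 0 s A.

Let F := normal_cdf s.

Lemma measurable_lipschitz_comp (h : R -> R) :
  (forall y y', `|h y - h y'| <= `|y - y'|) -> measurable_fun [set: O] (h \o Z).
Proof.
move=> hL; apply: measurableT_comp => //; apply: continuous_measurable_fun => y.
apply/cvgrPdist_lt => e e0; have := nbhsx_ballx y e e0.
by apply: filterS => y'; rewrite /ball/=; exact: le_lt_trans.
Qed.

Let mZA (A : set R) : measurable A -> measurable [set o | A (Z o)].
Proof. by move=> mA; rewrite -[X in measurable X]setTI; exact: mZ. Qed.

Let test1 (k : R) (h : R -> R) : k <= 1 -> (forall y, 0 <= h y) ->
  (forall y, h y <= k) -> forall y, `|h y| <= 1.
Proof. by move=> k1 h0 hk y; rewrite ger0_norm//; exact: le_trans (hk y) k1. Qed.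

Lemma lower_ramp_integral_le a k : 0 < k ->
  (\int[Pr]_o (lower_ramp a k (Z o))%:E <= (k * F (a + k))%:E)%E.
Proof.
move=> k0; rewrite EFinM -normal_cdfE -ZE//.
apply: integral_le_prob.
- exact: (measurable_lipschitz_comp (lower_ramp_lipschitz a k)).
- exact: mZA.
- exact: ltW.
- by move=> o; exact: lower_ramp_ge0.
- by move=> o; apply: lower_ramp_le; exact: ltW.
- by move=> o /=; rewrite in_itv/= => /negP; rewrite -ltNge => /lower_ramp_le0.
Qed.

Lemma lower_ramp_integral_ge a k : 0 < k ->
  ((k * F a)%:E <= \int[Pr]_o (lower_ramp a k (Z o))%:E)%E.
Proof.
move=> k0; rewrite EFinM -normal_cdfE -ZE//.
apply: prob_le_integral.
- exact: (measurable_lipschitz_comp (lower_ramp_lipschitz a k)).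
- exact: mZA.
- exact: ltW.
- by move=> o; exact: lower_ramp_ge0.
- by move=> o /=; rewrite in_itv/= => /lower_ramp_ge.
Qed.

(** The extra [- k] at the left end replaces a closed interval by a half-open one,
whose mass is a difference of two values of [F]. *)
Lemma trapezoid_integral_le a b k : 0 < k -> a <= b ->
  (\int[Pr]_o (trapezoid a b k (Z o))%:E <= (k * (F (b + k) - F (a - k - k)))%:E)%E.
Proof.
move=> k0 ab; rewrite EFinM -normal_cdf_itv; last by lra.
rewrite -ZE//; apply: integral_le_prob.
- exact: (measurable_lipschitz_comp (trapezoid_lipschitz a b k)).
- exact: mZA.
- exact: ltW.
- by move=> o; exact: trapezoid_ge0.
- by move=> o; apply: trapezoid_le; exact: ltW.
- move=> o /= h; apply: trapezoid_le0; apply/negP => /andP[h1 h2]; apply: h.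
  by rewrite in_itv/= h2 andbT; lra.
Qed.

Lemma trapezoid_integral_ge a b k : 0 < k ->
  ((k * (F b - F a))%:E <= \int[Pr]_o (trapezoid a b k (Z o))%:E)%E.
Proof.
move=> k0; have [ab|/ltW ba] := leP a b; last first.
  apply: (@le_trans _ _ 0%E).
    by rewrite lee_fin pmulr_rle0// subr_le0; exact: normal_cdf_nondecreasing.
  by apply: integral_ge0 => o _; rewrite lee_fin trapezoid_ge0.
rewrite EFinM -normal_cdf_itv// -ZE//; apply: prob_le_integral.
- exact: (measurable_lipschitz_comp (trapezoid_lipschitz a b k)).
- exact: mZA.
- exact: ltW.
- by move=> o; exact: trapezoid_ge0.
- by move=> o /=; rewrite in_itv/= => /andP[h1 h2]; apply: trapezoid_ge; rewrite h2 ltW.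
Qed.

(** The half-line up to [a] is compared with the ramps that start to decrease at
[a - k] and at [a]. *)
Lemma outer_cdf_close dT (T : measurableType dT) (mu : probability T R)
    (Y : T -> R) (k r : R) : 0 < k <= 1 ->
  (forall h : R -> R, (forall y y', `|h y - h y'| <= `|y - y'|) ->
     (forall y, `|h y| <= 1) ->
     (`| outer_expectation mu (fun w => (h (Y w))%:E)
         - \int[Pr]_o (h (Z o))%:E | < (k * r)%:E)%E) ->
  forall a, ((F (a - k) - r)%:E <= outer_prob mu [set w | (Y w <= a)%R]
             <= (F (a + k) + r)%:E)%E.
Proof.
move=> /andP[k0 k1] hY a.
have k0' := ltW k0.
have ifin (h : R -> R) : (forall y, 0 <= h y) -> (forall y, h y <= k) ->
    (forall y y', `|h y - h y'| <= `|y - y'|) ->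
    (\int[Pr]_o (h (Z o))%:E)%E \is a fin_num.
  move=> h0 hk hL; rewrite ge0_fin_numE; last first.
    by apply: integral_ge0 => o _; rewrite lee_fin.
  apply: (@le_lt_trans _ _ (k%:E * Pr setT)%E); last first.
    by rewrite probability_setT mule1 ltry.
  apply: integral_le_prob.
  - exact: (measurable_lipschitz_comp hL).
  - exact: measurableT.
  - exact: k0'.
  - by move=> o; exact: h0.
  - by move=> o; exact: hk.
  - by move=> o /(_ I).
apply/andP; split.
- pose h := lower_ramp (a - k) k.
  have hL := lower_ramp_lipschitz (a - k) k.
  have h0 := lower_ramp_ge0 (a - k) k.
  have hk y : h y <= k by exact: lower_ramp_le.
  have := hY h hL (test1 k1 h0 hk).
  have := lower_ramp_integral_ge (a - k) k0.
  rewrite -(fineK (ifin h h0 hk hL)) lee_fin => le1 /abse_subr_lt/andP[le2 _].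
  rewrite -(lee_pmul2l (x := k%:E))//.
  apply: (@le_trans _ _ (outer_expectation mu (EFin \o (h \o Y)))).
    by apply: le_trans le2; rewrite -EFinM lee_fin mulrBr; lra.
  apply: outer_expectation_le_prob => //.
  + by move=> w; exact: hk.
  + by move=> w /= /negP; rewrite -ltNge => wa; apply: lower_ramp_le0; rewrite subrK.
- pose h := lower_ramp a k.
  have hL := lower_ramp_lipschitz a k.
  have h0 := lower_ramp_ge0 a k.
  have hk y : h y <= k by exact: lower_ramp_le.
  have := hY h hL (test1 k1 h0 hk).
  have := lower_ramp_integral_le a k0.
  rewrite -(fineK (ifin h h0 hk hL)) lee_fin => le1 /abse_subr_lt/andP[_ le2].
  rewrite -(lee_pmul2l (x := k%:E))//.
  apply: (@le_trans _ _ (outer_expectation mu (EFin \o (h \o Y)))).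
    apply: outer_prob_markov => //.
    + by move=> w; exact: h0.
    + by move=> w /=; exact: lower_ramp_ge.
  by apply: le_trans le2 _; rewrite -EFinM lee_fin mulrDr; lra.
Qed.

Section unconditional.
Context dS (S : measurableType dS) (P0 : probability S R).
Variable Y : forall n, n.-tuple S -> R.
Hypothesis Ycvg : forall h : R -> R, (forall y y', `|h y - h y'| <= `|y - y'|) ->
  (forall y, `|h y| <= 1) ->
  outer_expectation (iid_law P0 n) (fun x => (h (Y x))%:E) @[n --> \oo]
    --> (\int[Pr]_o (h (Z o))%:E)%E.

Lemma outer_itv_le a b k r : 0 < k <= 1 -> 0 < r -> a <= b ->
  \forall n \near \oo, (outer_P0 P0 [set x : n.-tuple S | (a <= Y x <= b)%R]
    <= (F (b + k) - F (a - k - k) + r)%:E)%E.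
Proof.
move=> /andP[k0 k1] r0 ab; have k0' := ltW k0.
pose h := trapezoid a b k.
have h0 := trapezoid_ge0 a b k.
have hk y : h y <= k by exact: trapezoid_le.
have := Ycvg (trapezoid_lipschitz a b k) (test1 k1 h0 hk).
have lt1 : (\int[Pr]_o (h (Z o))%:E
    < (k * (F (b + k) - F (a - k - k) + r))%:E)%E.
  apply: le_lt_trans (trapezoid_integral_le k0 ab) _.
  by rewrite lte_fin ltr_pM2l// ltrDl.
move=> /cvge_lt_near/(_ lt1); apply: filterS => n hn.
rewrite /outer_P0 -outer_probE -(lee_pmul2l (x := k%:E))// -EFinM.
apply: le_trans (ltW hn); apply: outer_prob_markov.
- exact: k0.
- by move=> x; exact: h0.
- by move=> x /=; exact: trapezoid_ge.
Qed.

Lemma outer_itv_ge a b k r : 0 < k <= 1 -> 0 < r ->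
  \forall n \near \oo, ((F (b - k) - F (a + k) - r)%:E <=
    outer_P0 P0 [set x : n.-tuple S | (a <= Y x <= b)%R])%E.
Proof.
move=> /andP[k0 k1] r0; have k0' := ltW k0.
pose h := trapezoid (a + k) (b - k) k.
have h0 := trapezoid_ge0 (a + k) (b - k) k.
have hk y : h y <= k by exact: trapezoid_le.
have := Ycvg (trapezoid_lipschitz (a + k) (b - k) k) (test1 k1 h0 hk).
have lt1 : ((k * (F (b - k) - F (a + k) - r))%:E < \int[Pr]_o (h (Z o))%:E)%E.
  apply: lt_le_trans (trapezoid_integral_ge _ _ k0).
  by rewrite lte_fin ltr_pM2l// ltrBlDr ltrDl.
move=> /cvge_gt_near/(_ lt1); apply: filterS => n hn.
rewrite /outer_P0 -outer_probE -(lee_pmul2l (x := k%:E))// -EFinM.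
apply: le_trans (ltW hn) _; apply: outer_expectation_le_prob.
- exact: k0.
- by move=> x; exact: hk.
- move=> x /= /negP h1; apply: trapezoid_le0; rewrite subrK addrK//.
Qed.

End unconditional.

End normal_sandwich.

Section perturbed_cdf.
Context (R : realType) d (T : measurableType d) (mu : probability T R).

(** Off the exceptional sets a shift of the argument by [2 * k] turns the
distribution function of one variable into a bound for that of the other. *)
Lemma outer_cdf_perturb (U Y : T -> R) (B1 B2 : set T) (k r : R) (F : R -> R) :
  (forall a, ((F (a - k) - r)%:E <= outer_prob mu [set w | (Y w <= a)%R]
                <= (F (a + k) + r)%:E)%E) ->
  (outer_prob mu B1 < r%:E)%E -> (outer_prob mu B2 < r%:E)%E ->
  (forall w, ~ B1 w -> ~ B2 w -> `|U w - Y w| <= 2 * k) ->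
  forall z, ((F (z - 3 * k) - 3 * r)%:E <= outer_prob mu [set w | (U w <= z)%R]
                <= (F (z + 3 * k) + 3 * r)%:E)%E.
Proof.
move=> FY PB1 PB2 UY z.
have step (V V' : T -> R) (a b : R) :
    (forall w, ~ B1 w -> ~ B2 w -> V w <= a -> V' w <= b) ->
    (outer_prob mu [set w | (V w <= a)%R] <=
     outer_prob mu [set w | (V' w <= b)%R] + (2 * r)%:E)%E.
  move=> VV'.
  apply: (@le_trans _ _ (outer_prob mu ([set w | V' w <= b] `|` (B1 `|` B2)))).
    apply: outer_prob_le => w /= Va.
    have [B1w|B1w] := pselect (B1 w); first by right; left.
    have [B2w|B2w] := pselect (B2 w); first by right; right.
    by left; exact: VV'.
  apply: le_trans (outer_probU _ _ _) _; apply: leeD => //.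
  apply: le_trans (outer_probU _ _ _) _.
  by apply: le_trans (leeD (ltW PB1) (ltW PB2)) _; rewrite -EFinD lee_fin; lra.
have /andP[h1 _] := FY (z - 2 * k); have /andP[_ h2] := FY (z + 2 * k).
have s1 := step Y U (z - 2 * k) z.
have s2 := step U Y z (z + 2 * k).
apply/andP; split.
- rewrite -(leeD2rE _ _ (x := (2 * r)%:E))//.
  apply: (@le_trans _ _ (outer_prob mu [set w | (Y w <= z - 2 * k)%R])).
    apply: le_trans h1; rewrite -EFinD lee_fin.
    have -> : z - 2 * k - k = z - 3 * k by ring.
    by lra.
  apply: s1 => w nB1 nB2 Ya; have := UY w nB1 nB2; rewrite ler_norml; lra.
- apply: (@le_trans _ _ (outer_prob mu [set w | (Y w <= z + 2 * k)%R] + (2 * r)%:E)%E).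
    apply: s2 => w nB1 nB2 Ua; have := UY w nB1 nB2; rewrite ler_norml; lra.
  have -> : z + 3 * k = z + 2 * k + k by ring.
  have -> : F (z + 2 * k + k) + 3 * r = F (z + 2 * k + k) + r + 2 * r by ring.
  by rewrite EFinD; exact: leeD.
Qed.

End perturbed_cdf.

(** * Quantiles of an approximate distribution function *)

(** [J] is an approximate distribution function and [quantile] its generalized
inverse.  As [J] need not be continuous from the right, the inverse inequalities
hold only after a shift by an arbitrarily small [k]. *)
Section quantile.
Context (R : realType) (F : R -> R) (J : R -> \bar R) (c sn e : R).
Hypothesis sn0 : 0 < sn.
Hypothesis Fnd : forall a b, a <= b -> F a <= F b.
Hypothesis JF : forall z,
  ((F (sn * (z - c)) - e)%:E <= J z <= (F (sn * (z - c)) + e)%:E)%E.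
Implicit Types p v k : R.

Let quantile p : \bar R := ereal_inf [set z%:E | z in [set z : R | (p%:E <= J z)%E]].

Lemma quantile_le p v : p <= F (sn * (v - c)) - e -> (quantile p <= v%:E)%E.
Proof.
move=> pv; apply: ereal_inf_lbound; exists v => //=.
by have /andP[h _] := JF v; apply: le_trans h; rewrite lee_fin.
Qed.

Lemma quantile_le_inv p v k : (quantile p <= v%:E)%E -> 0 < k ->
  p <= F (sn * (v - c) + k) + e.
Proof.
move=> qv k0.
have : (quantile p < (v + k / sn)%:E)%E.
  by apply: le_lt_trans qv _; rewrite lte_fin ltrDl divr_gt0.
move=> /ereal_inf_lt[_ [z /= pz <-]]; rewrite lte_fin => zv.
have /andP[_ h] := JF z; have := le_trans pz h; rewrite lee_fin => h'.
apply: le_trans h' _; rewrite lerD2r; apply: Fnd.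
rewrite -lerBlDl; have -> : sn * (z - c) - sn * (v - c) = sn * (z - v) by ring.
by rewrite mulrC -ler_pdivlMr// lerBlDl ltW.
Qed.

Lemma quantile_ge p v : F (sn * (v - c)) + e < p -> (v%:E <= quantile p)%E.
Proof.
move=> vp; apply: le_ereal_inf_tmp => _ [z /= pz <-]; rewrite lee_fin leNgt.
apply/negP => zv; have /andP[_ h] := JF z.
have := le_trans pz h; rewrite lee_fin; apply/negP; rewrite -ltNge.
apply: le_lt_trans vp; rewrite lerD2r; apply: Fnd.
by rewrite ler_pM2l// lerD2r ltW.
Qed.

Lemma quantile_ge_inv p v k : (v%:E <= quantile p)%E -> 0 < k ->
  F (sn * (v - c) - k) - e <= p.
Proof.
move=> vq k0; rewrite leNgt; apply/negP => pF.
have : (quantile p <= (v - k / sn)%:E)%E.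
  apply: quantile_le; apply: le_trans (ltW pF) _; rewrite lerD2r; apply: Fnd.
  have -> // : sn * (v - k / sn - c) = sn * (v - c) - k by field; rewrite gt_eqF.
move=> /(le_trans vq); rewrite lee_fin; apply/negP; rewrite -ltNge.
by rewrite ltrBlDr ltrDl divr_gt0.
Qed.

End quantile.

Section percentile_event.
Context (R : realType) (s : R).
Hypothesis s0 : s != 0.
Let F := normal_cdf s.
Let C := normal_peak s.

(** Here [v] is the parameter, [c] the centre of the bootstrap law, [sn] the
square root of the sample size, and [Y] the normalized sampling error.  The
levels [b] and [1 - a] of the quantiles become the bounds [a] and [1 - b] for
[F Y] because [F (- Y) = 1 - F Y].  The loss [3 * e] is the sum of the accuracy
of [J], the shift by [k], and the distance from [sn * (v - c)] to [- Y]. *)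
Lemma percentile_event (J : R -> \bar R) (sn c v Y a b e k : R) :
  0 < sn -> 0 < k -> 0 < e -> C * (3 * k) <= e ->
  (forall z, ((F (sn * (z - c)) - e)%:E <= J z <= (F (sn * (z - c)) + e)%:E)%E) ->
  `|sn * (v - c) + Y| <= 3 * k ->
  let q p := ereal_inf [set z%:E | z in [set z : R | (p%:E <= J z)%E]] in
  ((q b <= v%:E)%E -> (v%:E <= q (1 - a)%R)%E -> a - 3 * e <= F Y <= 1 - b + 3 * e) /\
  (a + 3 * e <= F Y <= 1 - b - 3 * e -> (q b <= v%:E)%E /\ (v%:E <= q (1 - a)%R)%E).
Proof.
move=> sn0 k0 e0 Ck JF tY q.
have Fnd := normal_cdf_nondecreasing s0.
set t := sn * (v - c) in tY.
have FtY : F (- Y) - e <= F t <= F (- Y) + e.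
  by apply: (normal_cdf_shift s0 Ck); rewrite opprK.
have Ftk : F t - e <= F (t + k) <= F t + e.
  apply: (normal_cdf_shift s0 Ck); rewrite addrAC subrr add0r gtr0_norm//; lra.
have Ftk' : F t - e <= F (t - k) <= F t + e.
  apply: (normal_cdf_shift s0 Ck); rewrite addrAC subrr add0r normrN gtr0_norm//; lra.
rewrite /F normal_cdfN// -/F in FtY.
move: FtY Ftk Ftk' => /andP[f1 f2] /andP[f3 f4] /andP[f5 f6].
split.
- move=> /(quantile_le_inv sn0 Fnd JF)/(_ k0) h1 /(quantile_ge_inv sn0 Fnd JF)/(_ k0) h2.
  rewrite -/F -/t in h1 h2; lra.
- move=> /andP[h1 h2]; split.
  + apply: (quantile_le JF); rewrite -/t; lra.
  + apply: (quantile_ge sn0 Fnd JF); rewrite -/F -/t; lra.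
Qed.

End percentile_event.

(** * Coverage of the percentile interval *)

(** The event is squeezed between two intervals for [Y] whose end points are normal
quantiles with levels close to [a] and [1 - b]; the weak convergence of [Y]
gives the limit of their probabilities. *)
Lemma coverage_limit (R : realType) dS (S : measurableType dS) (P0 : probability S R)
    d (O : measurableType d) (Pr : probability O R) (Z : O -> R) (s : R)
    (Y : forall n, n.-tuple S -> R) (A : forall n, set (n.-tuple S)) (a b : R) :
  measurable_fun [set: O] Z -> s != 0 ->
  (forall B : set R, measurable B -> Pr [set o | B (Z o)] = normal_prob 0 s B) ->
  (forall h : R -> R, (forall y y', `|h y - h y'| <= `|y - y'|) ->
    (forall y, `|h y| <= 1) ->
    outer_expectation (iid_law P0 n) (fun x => (h (Y n x))%:E) @[n --> \oo]
      --> (\int[Pr]_o (h (Z o))%:E)%E) ->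
  0 < a -> 0 < b -> a + b < 1 ->
  (forall e, 0 < e -> whp P0 (fun n => [set x |
     (A n x -> a - e <= normal_cdf s (Y n x) <= 1 - b + e) /\
     (a + e <= normal_cdf s (Y n x) <= 1 - b - e -> A n x)])) ->
  outer_P0 P0 (A n) @[n --> \oo] --> (1 - a - b)%:E.
Proof.
move=> mZ s0 ZE Ycvg a0 b0 ab1 Awhp.
apply/cvg_EFin_near; first by move=> n; exact: outer_P0_fin_num.
move=> e e0.
(* The total error below is at most [8 * t]; the bounds by [a] and [b] keep the
   four quantile levels inside the open unit interval. *)
have [t [t0 te ta tb]] : exists t, [/\ 0 < t, 8 * t <= e, 3 * t <= a & 3 * t <= b].
  exists (Num.min (e / 8) (Num.min (a / 3) (b / 3))).
  have h1 : Num.min (e / 8) (Num.min (a / 3) (b / 3)) <= e / 8 by rewrite ge_min lexx.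
  have h2 : Num.min (e / 8) (Num.min (a / 3) (b / 3)) <= a / 3.
    by rewrite !ge_min lexx !orbT.
  have h3 : Num.min (e / 8) (Num.min (a / 3) (b / 3)) <= b / 3.
    by rewrite !ge_min lexx !orbT.
  by split; [rewrite !lt_min !divr_gt0|lra|lra|lra].
pose C := normal_peak s; have C0 : 0 < C by exact: normal_peak_gt0.
pose k := Num.min 1 (t / (3 * C)).
have k0 : 0 < k by rewrite lt_min ltr01 divr_gt0// mulr_gt0.
have k1 : k <= 1 by rewrite ge_min lexx.
have Ck : C * k * 3 <= t.
  have : k <= t / (3 * C) by rewrite ge_min lexx orbT.
  by rewrite ler_pdivlMr ?mulr_gt0//; lra.
have [a1 Fa1] : exists y, normal_cdf s y = a - 2 * t.
  by apply: normal_cdf_quantile => //; apply/andP; split; lra.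
have [b1 Fb1] : exists y, normal_cdf s y = 1 - b + 2 * t.
  by apply: normal_cdf_quantile => //; apply/andP; split; lra.
have [a2 Fa2] : exists y, normal_cdf s y = a + t.
  by apply: normal_cdf_quantile => //; apply/andP; split; lra.
have [b2 Fb2] : exists y, normal_cdf s y = 1 - b - t.
  by apply: normal_cdf_quantile => //; apply/andP; split; lra.
have Flt y y' : normal_cdf s y < normal_cdf s y' -> y <= y'.
  move=> h; rewrite leNgt; apply/negP => /ltW /(normal_cdf_nondecreasing s0).
  by rewrite leNgt h.
have a1b1 : a1 <= b1 by apply: Flt; rewrite Fa1 Fb1; lra.
have k01 : 0 < k <= 1 by rewrite k0.
have near1 := outer_itv_le mZ ZE Ycvg k01 t0 a1b1.
have near2 := outer_itv_ge mZ s0 ZE Ycvg a2 b2 k01 t0.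
have := whpP P0 (fun n => [set x |
     (A n x -> a - t <= normal_cdf s (Y n x) <= 1 - b + t) /\
     (a + t <= normal_cdf s (Y n x) <= 1 - b - t -> A n x)]).
move=> [/(_ (Awhp t t0))/(_ t t0) near3 _].
have shift y y' : y' - 2 * k <= y -> y <= y' + 2 * k ->
    normal_cdf s y' - t <= normal_cdf s y <= normal_cdf s y' + t.
  move=> h1 h2; apply: (@normal_cdf_shift _ _ s0 _ _ _ (2 * k)).
    by rewrite -/C; lra.
  by rewrite ler_norml; lra.
apply: filterS3 near1 near2 near3 => n N1 N2 N3.
set B := ~` _ in N3.
apply/andP; split.
- have sub : [set x | a2 <= Y n x <= b2] `<=` A n `|` B.
    move=> x /= /andP[h1 h2]; have [Bx|/contrapT[_ AY]] := pselect (B x); first by right.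
    left; apply: AY; rewrite -Fa2 -Fb2.
    by rewrite !normal_cdf_nondecreasing.
  have h := le_trans N2 (le_trans (outer_P0_le P0 sub) (outer_P0U P0 _ _)).
  have {}h := le_trans h (leeD (lexx _) N3).
  rewrite -(leeD2rE _ _ (x := t%:E))//; apply: le_trans h.
  rewrite -EFinD lee_fin.
  have /andP[g1 _] := shift (b2 - k) b2 ltac:(lra) ltac:(lra).
  have /andP[_ g2] := shift (a2 + k) a2 ltac:(lra) ltac:(lra).
  rewrite Fb2 in g1; rewrite Fa2 in g2; lra.
- have sub : A n `<=` [set x | a1 <= Y n x <= b1] `|` B.
    move=> x /= Ax; have [Bx|/contrapT[AY _]] := pselect (B x); first by right.
    left; have /andP[h1 h2] := AY Ax.
    by apply/andP; split; apply: Flt; [rewrite Fa1|rewrite Fb1]; lra.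
  have h := le_trans (outer_P0_le P0 sub) (outer_P0U P0 _ _).
  apply: le_trans h _; apply: le_trans (leeD N1 N3) _.
  rewrite -EFinD lee_fin.
  have /andP[_ g1] := shift (b1 + k) b1 ltac:(lra) ltac:(lra).
  have /andP[g2 _] := shift (a1 - k - k) a1 ltac:(lra) ltac:(lra).
  rewrite Fb1 in g1; rewrite Fa1 in g2; lra.
Qed.

Unset Implicit Arguments.

Theorem corollary3p13
  (R : realType)
  (d : nat) (dX : measure_display) (X : measurableType dX)
  (iota : X -> 'rV[R]_d) (iota_inj : injective iota)
  (M : set (probability X R)) (P0 : probability X R) (P0M : M P0)
  (psi : probability X R -> R)
  (H : Type) (eta : probability X R -> H)
  (T : H -> {measure set X -> \bar R} -> R)
  (psiT : psi P0 = T (eta P0) P0)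
  (phi0 : X -> R) (mphi0 : measurable_fun [set: X] phi0)
  (phi0_mean : \int[P0]_y phi0 y = 0)
  (phi0_var : (0 < \int[P0]_y (phi0 y ^+ 2)%:E < +oo)%E)
  (etan : forall n, n.-tuple X -> H)
  (phin : forall n, n.-tuple X -> X -> R)
  (dW : nat -> measure_display) (W : forall n, measurableType (dW n))
  (Q : forall n, probability (W n) R)
  (gamma : forall n, {mfun (n.-tuple X * W n)%type >-> X})
  (etas : forall n, n.-tuple X -> n.-tuple X -> H)
  (phis : forall n, n.-tuple X -> n.-tuple X -> X -> R)
  (alpha beta : R)
  (alpha01 : 0 < alpha < 1) (beta01 : 0 < beta < 1) (ab1 : alpha + beta < 1) :
  let Pn n (x : n.-tuple X) := empirical R x in
  let hatP n (x : n.-tuple X) := resample_law (gamma n) (Q n) x in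
  let Xs n (x : n.-tuple X) (w : n.-tuple (W n)) :=
    bootstrap_sample (gamma n) x w in
  let Ps n x w := empirical R (Xs n x w) in
  let rate (n : nat) : R := (Num.sqrt n%:R)^-1 in
  let psis n x w := T (etas n x (Xs n x w)) (Ps n x w) in
  let zeta n p x := boot_quantile Q (psis n) p x in
  (* A1 *)
  donsker_cond P0 phi0 phin ->
  (* A2 *)
  oP0 P0 (fun n x => 'N[P0]_2%:E[EFin \o (phin n x \- phi0)%R])%E (fun=> 1) ->
  (* A3 *)
  oP0 P0 (fun n x =>
    (linear_remainder T (etan n x) (Pn n x) (eta P0) P0 (phin n x))%:E) rate ->
  (* B1 *)
  boot_donsker_cond P0 Q gamma phi0 (fun n x w => phis n x (Xs n x w)) ->
  (* B2 *)
  oPW P0 Q (fun n x w =>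
    'N[P0]_2%:E[EFin \o (phis n x (Xs n x w) \- phi0)%R])%E (fun=> 1) ->
  (* B3 *)
  oPW P0 Q (fun n x w =>
    (linear_remainder T (etas n x (Xs n x w)) (Ps n x w)
       (etan n x) (hatP n x) (phis n x (Xs n x w)))%:E) rate ->
  oP0 P0 (fun n x =>
    (T (etan n x) (hatP n x) - T (etan n x) (Pn n x))%:E) rate ->
  outer_P0 P0 [set x | (zeta n beta x <= (psi P0)%:E <= zeta n (1 - alpha)%R x)%E]
    @[n --> \oo] --> (1 - alpha - beta)%:E.

Proof.
move=> Pn hatP Xs Ps rate psis zeta A1 A2 A3 B1 B2 B3 AB.
move: alpha01 beta01 => /andP[a0 _] /andP[b0 _].
have V0 : 0 < \int[P0]_y (phi0 y ^+ 2) - (\int[P0]_y phi0 y) ^+ 2.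
  rewrite phi0_mean expr0n subr0; apply: fine_gt0.
  by move/andP: phi0_var => [-> ->].
have [lin [dO [Om [Pr [Z [s [mZ law var Ycvg]]]]]]] := donsker_linearization A1 A2.
have [blin [dO' [Om' [Pr' [Z' [s' [mZ' law' var' bcvg]]]]]]] :=
  bootstrap_linearization B1 B2.
have [s0 lawE] := normal_law_of_variance V0 var var.
have [_ lawE'] := normal_law_of_variance V0 var var'.
rewrite lawE in law; rewrite lawE' in law'.
pose Y n (x : n.-tuple X) := scaled_diff n (Pn n x) P0 phi0.
apply: (coverage_limit (Y := Y) mZ s0 law Ycvg a0 b0 ab1) => e e0.
(* [percentile_event] loses three times its accuracy, which is [4 * r] here. *)
pose r := e / 12; have r0 : 0 < r by rewrite divr_gt0.
pose C := normal_peak s; have C0 : 0 < C by exact: normal_peak_gt0.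
pose k := Num.min 1 (r / (3 * C)).
have k0 : 0 < k by rewrite lt_min ltr01 divr_gt0// mulr_gt0.
have k1 : 0 < k <= 1 by rewrite k0 ge_min lexx.
have Ck : C * (3 * k) <= r.
  have : k <= r / (3 * C) by rewrite ge_min lexx orbT.
  by rewrite ler_pdivlMr ?mulr_gt0//; lra.
have kr0 : 0 < k * r by rewrite mulr_gt0.
have w1 := lin k k0.
have w2 := cvg0_outer_whp A3 k0.
have w3 := cvg0_outer_whp AB k0.
have w4 := blin k r k0 r0.
have w5 := bcvg (k * r) kr0.
have w6 := cvg0_outer_whp (B3 k k0) r0.
apply: whpS (whpI w1 (whpI w2 (whpI w3 (whpI w4 (whpI w5 w6))))) _.
near=> n => x /= [h1 [h2 [h3 [h4 [h5 h6]]]]].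
have n0 : (0 < n)%N by near: n; exists 1%N.
have sn0 : 0 < Num.sqrt (n%:R : R) by rewrite sqrtr_gt0 ltr0n.
pose mu := iid_law (Q n) n.
pose c := T (etan n x) (hatP n x).
pose Yw (w : n.-tuple (W n)) := scaled_diff n (Ps n x w) (hatP n x) phi0.
pose U (w : n.-tuple (W n)) := Num.sqrt n%:R * (psis n x w - c).
have rateV : (rate n)^-1 = Num.sqrt n%:R by rewrite invrK.
rewrite rateV lte_fin in h2.
rewrite rateV lte_fin in h3.
rewrite gee0_abs in h6; last exact: outer_prob_ge0.
have close := outer_cdf_close mZ' law' k1 h5.
have UY w :
    ~ (k <= `|scaled_diff n (Ps n x w) (hatP n x) (phis n x (Xs n x w)) - Yw w|) ->
    ~ (k%:E <= `|(linear_remainder T (etas n x (Xs n x w)) (Ps n x w)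
         (etan n x) (hatP n x) (phis n x (Xs n x w)))%:E * ((rate n)^-1)%:E|)%E ->
    `|U w - Yw w| <= 2 * k.
  rewrite rateV -EFinM abse_EFin lee_fin => /negP + /negP; rewrite -!ltNge => g1 g2.
  (* [U w] is exactly the remainder plus the centred bootstrap mean. *)
  have -> : U w - Yw w =
      linear_remainder T (etas n x (Xs n x w)) (Ps n x w)
         (etan n x) (hatP n x) (phis n x (Xs n x w)) * Num.sqrt n%:R +
      (scaled_diff n (Ps n x w) (hatP n x) (phis n x (Xs n x w)) - Yw w).
    rewrite /U /linear_remainder /scaled_diff /psis /c; ring.
  apply: le_trans (ler_normD _ _) _; lra.
have Ucdf := outer_cdf_perturb close h4 h6 UY.
(* A shift of the argument by [3 * k] changes [normal_cdf s] by at most [r]. *)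
have JF z : ((normal_cdf s (Num.sqrt n%:R * (z - c)) - 4 * r)%:E <=
    outer_PW Q (fun x => [set w | (psis n x w <= z)%R]) x <=
    (normal_cdf s (Num.sqrt n%:R * (z - c)) + 4 * r)%:E)%E.
  have -> : outer_PW Q (fun x => [set w | psis n x w <= z]) x =
      outer_prob mu [set w | U w <= Num.sqrt n%:R * (z - c)].
    congr (outer_prob mu _); apply/seteqP; split => w /=;
      by rewrite /U ler_pM2l// lerD2r.
  have /andP[g1 g2] := Ucdf (Num.sqrt n%:R * (z - c)).
  apply/andP; split.
  - apply: le_trans g1; rewrite lee_fin.
    have /andP[] : normal_cdf s (Num.sqrt n%:R * (z - c)) - r <=
       normal_cdf s (Num.sqrt n%:R * (z - c) - 3 * k) <=
       normal_cdf s (Num.sqrt n%:R * (z - c)) + r.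
      apply: (normal_cdf_shift s0 Ck).
      by rewrite addrAC subrr add0r normrN gtr0_norm// mulr_gt0.
    lra.
  - apply: le_trans g2 _; rewrite lee_fin.
    have /andP[] : normal_cdf s (Num.sqrt n%:R * (z - c)) - r <=
       normal_cdf s (Num.sqrt n%:R * (z - c) + 3 * k) <=
       normal_cdf s (Num.sqrt n%:R * (z - c)) + r.
      apply: (normal_cdf_shift s0 Ck).
      by rewrite addrAC subrr add0r gtr0_norm// mulr_gt0.
    lra.
have tY : `|Num.sqrt n%:R * (psi P0 - c) + Y n x| <= 3 * k.
  have -> : Num.sqrt n%:R * (psi P0 - c) + Y n x =
    - (linear_remainder T (etan n x) (Pn n x) (eta P0) P0 (phin n x) * Num.sqrt n%:R
     + (T (etan n x) (hatP n x) - T (etan n x) (Pn n x)) * Num.sqrt n%:R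
     + (scaled_diff n (Pn n x) P0 (phin n x) - scaled_diff n (Pn n x) P0 phi0)).
    rewrite /Y /linear_remainder /scaled_diff psiT /c; ring.
  rewrite normrN; apply: le_trans (ler_normD _ _) _.
  have := ler_normD (linear_remainder T (etan n x) (Pn n x) (eta P0) P0 (phin n x)
    * Num.sqrt n%:R) ((T (etan n x) (hatP n x) - T (etan n x) (Pn n x)) * Num.sqrt n%:R).
  move: h1 h2 h3; rewrite -/(Pn n x); lra.
have r4 : 0 < 4 * r by rewrite mulr_gt0.
have Ck4 : C * (3 * k) <= 4 * r by lra.
have [AY YA] := percentile_event s0 alpha beta sn0 k0 r4 Ck4 JF tY.
have er : e = 3 * (4 * r) by rewrite /r; field.
rewrite er; split.
- by move=> /andP[]; exact: AY.
- by move=> /YA[z1 z2]; apply/andP; split.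
Unshelve. all: by end_near. Qed.
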